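(* Let $d\in[0,1]$ and let $(\boldsymbol{w}_n)_{n\to\infty}$ be a sequence of words $\boldsymbol{w}_n\in\{0,1\}^n$ such that $\|\boldsymbol{w}_n\|_1=dn+o(n)$. Then the following are equivalent: \begin{itemize} \item (Uniformity) $(\boldsymbol{w}_n)_{n\to\infty}$ is $(d,o(1))$-uniform. \item (Counting) For all $\ell\in\mathbb{N}$ and all $\boldsymbol{u}\in\{0,1\}^\ell$ we have $\binom{\boldsymbol{w}_n}{\boldsymbol{u}}=d^{\|\boldsymbol{u}\|_1}(1-d)^{\ell-\|\boldsymbol{u}\|_1}\binom n\ell+o(n^\ell)$. \item (Minimizer) For all $\boldsymbol{u}\in\{0,1\}^3$ we have $\binom{\boldsymbol{w}_n}{\boldsymbol{u}}=d^{\|\boldsymbol{u}\|_1}(1-d)^{3-\|\boldsymbol{u}\|_1}\binom n3+o(n^3)$. \item (Exponential sums) For any fixed $k\in\mathbb{N}$, $k\neq 0$, we have $\frac1n\sum_{j\in[n]}\boldsymbol{w}_n[j]\cdot\exp\left(\frac{2\pi i}{n}kj\right)=o(1)$. \item (Equidistribution) For every Lipschitz function $f:\mathbb{R}/\mathbb{Z}\to\mathbb{C}$ we have $\frac1n\sum_{j\in[n]}\boldsymbol{w}_n[j]\cdot f\left(\frac jn\right)=d\int_{\mathbb{R}/\mathbb{Z}}f+o(1)$. \item (Cayley graph) For all $\boldsymbol{u}\in\{0,1\}^3$ the number of induced $\boldsymbol{u}$-walks in $\Gamma(\boldsymbol{w}_n)$ is $d^{\|\boldsymbol{u}\|_1}(1-d)^{3-\|\boldsymbol{u}\|_1}2n\binom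 n3+o(n^4)$. \end{itemize}
   Context: Here $[n]=\{1,\dots,n\}$. For a word $\boldsymbol{w}\in\{0,1\}^n$, $\boldsymbol{w}[j]$ is its $j$-th letter and $\|\boldsymbol{w}\|_1$ its number of 1-entries. For $\boldsymbol{u}\in\{0,1\}^\ell$, $\binom{\boldsymbol{w}}{\boldsymbol{u}}$ is the number of sets $\{i_1<\dots<i_\ell\}\subseteq[n]$ with $\boldsymbol{w}[i_j]=\boldsymbol{u}[j]$ for all $j\in[\ell]$. A word $\boldsymbol{w}\in\{0,1\}^n$ is $(d,\varepsilon)$-uniform if for every interval $I\subseteq[n]$ (set of consecutive integers) $\left|\sum_{i\in I}\boldsymbol{w}[i]-d|I|\right|\le\varepsilon n$; the sequence is $(d,o(1))$-uniform if there are $\varepsilon_n\to0$ such that $\boldsymbol{w}_n$ is $(d,\varepsilon_n)$-uniform for every $n$. All $o(\cdot)$ terms are as $n\to\infty$, with the other parameters ($\boldsymbol{u}$, $\ell$, $k$, $f$) fixed. $\mathbb{R}/\mathbb{Z}$ carries the metric $\min\{|x-y|,1-|x-y|\}$ (for representatives in $[0,1)$) and normalized Lebesgue measure. The Cayley digraph $\Gamma(\boldsymbol{w})$ of $\boldsymbol{w}=(w_1,\dots,w_n)$ is the digraph on vertex set $\mathbb{Z}_{2n}$ in which there is an edge from $v$ to $v+i \pmod{2n}$ for every vertex $v$ and every $i\in[n]$ with $w_i=1$. Given $\boldsymbol{u}=(u_1,\dots,u_\ell)\in\{0,1\}^\ell$, a sequence of vertices $(v_1,\dots,v_{\ell+1})$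 is an induced $\boldsymbol{u}$-walk in $\Gamma(\boldsymbol{w})$ if there are numbers $i_1,\dots,i_\ell\in[n]$ with $v_{k+1}=v_k+i_k\pmod{2n}$ for $k\in[\ell]$, satisfying $i_1<\dots<i_\ell$, and for each $k\in[\ell]$ the pair $(v_k,v_{k+1})$ is an edge of $\Gamma(\boldsymbol{w})$ if and only if $u_k=1$. *)

(* Defs.v *)
From mathcomp Require Import all_boot all_order all_algebra.
From mathcomp Require Import generic_quotient.
From mathcomp Require Import complex.
From mathcomp Require Import all_classical all_reals all_analysis.

Set Implicit Arguments.
Unset Strict Implicit.
Unset Printing Implicit Defensive.

Import Order.TTheory GRing.Theory Num.Theory.
Import numFieldNormedType.Exports.

Local Open Scope classical_set_scope.
Local Open Scope ring_scope.
Local Open Scope complex_scope.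

(** The letter of w at position i.+1 of [n] = {1, ..., n} is [tnth w i], with
    i : 'I_n. *)

Section Words.
Local Open Scope nat_scope.

Definition ones n (w : n.-tuple bool) : nat := \sum_(i < n) tnth w i.

Definition is_interval n (I : {set 'I_n}) : Prop :=
  exists a b : nat, I = [set i : 'I_n | a <= i < b]%SET.

(** [enum S] lists the elements of S in increasing order. *)
Definition subword_count n l (w : n.-tuple bool) (u : l.-tuple bool) : nat :=
  #|[set S : {set 'I_n} | [seq tnth w i | i <- enum S] == u :> seq bool]%SET|.

(** The vertex set Z_2n is 'I_(2 * n), with addition written modulo 2 * n, so
    that it is empty for n = 0 (whereas 'Z_0 has two elements). *)
Definition cayley_edge n (w : n.-tuple bool) : rel 'I_(2 * n) :=
  fun v v' => [exists i : 'I_n, tnth w i && (v' == (v + i.+1) %% (2 * n) :> nat)].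

(** For k : 'I_l, [widen_ord (leqnSn l) k] and [lift ord0 k] are the indices
    k and k + 1 of 'I_l.+1. *)
Definition induced_walk n l (w : n.-tuple bool) (u : l.-tuple bool)
    (v : l.+1.-tuple 'I_(2 * n)) : bool :=
  [exists t : l.-tuple 'I_n,
    [&& sorted ltn [seq val i | i <- t],
        [forall k : 'I_l, tnth v (lift ord0 k) ==
           (tnth v (widen_ord (leqnSn l) k) + (tnth t k).+1) %% (2 * n) :> nat]
      & [forall k : 'I_l,
           cayley_edge w (tnth v (widen_ord (leqnSn l) k)) (tnth v (lift ord0 k))
           == tnth u k]]].

Definition induced_walk_count n l (w : n.-tuple bool) (u : l.-tuple bool) : nat :=
  #|[set v : l.+1.-tuple 'I_(2 * n) | induced_walk w u v]%SET|.

End Words.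

Section Uniformity.
Variable R : realType.

Definition uniform_word (d eps : R) n (w : n.-tuple bool) : Prop :=
  forall I : {set 'I_n}, is_interval I ->
    `| \sum_(i in I) (tnth w i)%:R - d * #|I|%:R | <= eps * n%:R.

Definition uniform_seq (d : R) (w : forall n, n.-tuple bool) : Prop :=
  exists2 eps : nat -> R, eps n @[n --> \oo] --> (0 : R) &
    forall n, uniform_word d (eps n) (w n).

End Uniformity.

Section Circle.
Local Open Scope quotient_scope.
Variable R : realType.

Definition eqmodZ (x y : R) : bool := (x - y) \is a Num.int.

Lemma eqmodZ_refl : reflexive eqmodZ.
Proof. by move=> x; rewrite /eqmodZ subrr rpred0. Qed.

Lemma eqmodZ_sym : symmetric eqmodZ.
Proof. by move=> x y; rewrite /eqmodZ -opprB rpredN. Qed.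

Lemma eqmodZ_trans : transitive eqmodZ.
Proof.
move=> y x z; rewrite /eqmodZ => xy yz.
by rewrite -(subrKA y) rpredD.
Qed.

Canonical eqmodZ_equiv := EquivRel eqmodZ eqmodZ_refl eqmodZ_sym eqmodZ_trans.

Definition circle : Type := {eq_quot eqmodZ_equiv}.

Definition to_circle (x : R) : circle := \pi_({eq_quot eqmodZ_equiv}) x.

(** The representative in [0, 1). *)
Definition circle_rep (p : circle) : R :=
  let x := repr (p : {eq_quot eqmodZ_equiv}) in x - (Num.floor x)%:~R.

Definition circle_dist (p q : circle) : R :=
  let t := `| circle_rep p - circle_rep q | in Num.min t (1 - t).

Definition circle_lipschitz (f : circle -> R[i]) : Prop :=
  exists K : R, forall p q, `| f p - f q | <= (K * circle_dist p q)%:C.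

(** The normalized Lebesgue measure of R/Z is the image of the Lebesgue measure
    of [0, 1[, and a complex function is integrated componentwise. *)
Definition circle_integral (f : circle -> R[i]) : R[i] :=
  Rintegral lebesgue_measure `[0, 1[ (fun x : R => complex.Re (f (to_circle x)))
  +i* Rintegral lebesgue_measure `[0, 1[ (fun x : R => complex.Im (f (to_circle x))).

Definition cexp (z : R[i]) : R[i] :=
  (expR (complex.Re z))%:C * (cos (complex.Im z) +i* sin (complex.Im z)).

End Circle.

(* Main.v *)
Require Import Defs.
From mathcomp Require Import all_boot all_order all_algebra.
From mathcomp Require Import complex.
From mathcomp Require Import all_classical all_reals all_analysis.
From mathcomp Require Import zify ring lra.

Import Order.TTheory GRing.Theory Num.Theory.
Import numFieldNormedType.Exports.

Local Open Scope classical_set_scope.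
Local Open Scope ring_scope.
Local Open Scope complex_scope.

(** Fix a length [n] and let [S_m], for [m <= n], be the sum of [w_i - d] over
    the first [m] positions. All six properties are equivalent to one
    statement, [balanced]: the maximum over [m <= n] of [|S_m|] is [o(n)].

    Uniformity is [balanced] since the sum over an interval is a difference of
    two [S_m] ([uniform_balanced]).

    Counting follows from [balanced] by induction on the length of the pattern.
    Splitting off its last letter writes the count as a sum over the position
    of that letter; the error made in replacing the letter at [j] by its
    density is a sum of [(w_j - d)] times a monotone weight, and summation by
    parts bounds it by the discrepancy ([occ_uniform]). Counting contains the
    minimizer property. Conversely the sum over [k] of [S_k ^ 2] is, up to
    [O(n ^ 2)], twice the sum of [(w_i - d) * (w_j - d)] over [i < j < k],
    which is a combination of the eight counts of patterns of length 3; the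
    main terms cancel, so the mean square of [S] is [o(n ^ 2)]. As [S] moves
    by at most 1 at each step, a small mean square forces a small maximum
    ([sup_from_mean_square]); this is [minimizer_balanced].

    An induced walk is the choice of a first vertex, in [2 * n] ways, and of
    increasing step lengths spelling the pattern: a step in [1, n] is
    determined by its residue modulo [2 * n]. So walk counts are [2 * n] times
    subword counts ([induced_walk_countE]), and the Cayley graph property is
    the minimizer property.

    Equidistribution follows from [balanced] by summation by parts against the
    samples of the Lipschitz test function, together with the convergence of
    Riemann sums ([balanced_weighted_average]). The characters of the circle
    are Lipschitz test functions with integral 0, which gives the exponential
    sums.

    It remains to return from exponential sums to [balanced]
    ([expsum_balanced]). Recentre [w] at its empirical density, so that the
    partial sums are periodic modulo [n], and subtract their mean; let [T] be
    the result. The discrete Fourier coefficient of [T] at [k] is that of the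
    increments divided by a number of modulus [2 * sin (pi * k / n)], which is
    at least a constant times [min k (n - k) / n]. By Parseval, frequencies
    with [min k (n - k) > K] contribute [O(1 / K ^ 2)] of the trivial bound to
    the mean square of [T], and the remaining ones are bounded by finitely
    many exponential sums. Hence the mean square of [T] is [o(n ^ 2)], and so
    is its maximum squared. *)

(** * Subword counts by recursion on the last letter *)

Section Occurrences.
Local Open Scope nat_scope.
Set Implicit Arguments.
Unset Strict Implicit.

(** The pattern [u] is listed from its last letter to its first: the position of
    that letter is then the length of the prefix available to the others, and
    the recursion is structural. *)
Fixpoint occ (w : nat -> bool) (m : nat) (u : seq bool) : nat :=
  if u is b :: u' then \sum_(j < m | w j == b) occ w j u' else 1.

Lemma occ_nil w m : occ w m [::] = 1. Proof. by []. Qed.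

Lemma occ0 w b u : occ w 0 (b :: u) = 0. Proof. exact: big_ord0. Qed.

Lemma occS (w : nat -> bool) m b u :
  occ w m.+1 (b :: u) = occ w m (b :: u) + (w m == b) * occ w m u.
Proof.
rewrite /= [in LHS]big_mkcond big_ord_recr /= -big_mkcond /=.
by case: (w m == b); rewrite ?mul1n ?mul0n.
Qed.

Lemma big_rcons_tuple (n : nat) (F : seq bool -> nat) :
  \sum_(m : n.+1.-tuple bool) F m =
  \sum_(m : n.-tuple bool) (F (rcons m false) + F (rcons m true)).
Proof.
pose h (p : n.-tuple bool * bool) := [tuple of rcons p.1 p.2].
have hinj : injective h.
  move=> [s a] [t b] /(congr1 val) /= /rcons_inj [e ->].
  by congr (_, _); apply: val_inj.
have hbij : bijective h.
  apply: inj_card_bij => //.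
  by rewrite card_prod !card_tuple card_bool expnSr.
rewrite (reindex h) /=; last exact: onW_bij.
rewrite -(pair_bigA _ (fun (s : n.-tuple bool) b => F (rcons s b))) /=.
by apply: eq_bigr => s _; rewrite big_bool addnC.
Qed.

(** Subsets of positions are encoded as masks, for which the last position can
    be split off; both sides then satisfy the recursion [occS]. *)
Lemma mask_count_occ (w : nat -> bool) n (u : seq bool) :
  \sum_(m : n.-tuple bool) (mask m (mkseq w n) == u) = occ w n (rev u).
Proof.
elim: n u => [|n IH] u.
  rewrite (eq_bigr (fun=> (u == [::]) : nat)); last first.
    by move=> m _; rewrite (tuple0 m) eq_sym.
  rewrite sum_nat_const card_tuple mul1n.
  case/lastP: u => [//|u a]; rewrite rev_rcons /= big_ord0.
  by case: u.
rewrite (big_rcons_tuple n (fun m => (mask m (mkseq w n.+1) == u) : nat)).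
rewrite mkseqS (eq_bigr (fun m : n.-tuple bool =>
   (mask m (mkseq w n) == u) + (rcons (mask m (mkseq w n)) (w n) == u))); last first.
  move=> m _; rewrite !mask_rcons ?size_mkseq ?size_tuple //=.
  by rewrite cats0 cats1.
rewrite big_split /= IH.
case/lastP: u => [|u b].
  rewrite big1 ?addn0 // => m _.
  by case: (mask _ _).
rewrite rev_rcons occS; congr (_ + _).
rewrite -IH big_distrr /=; apply: eq_bigr => m _.
by rewrite eqseq_rcons mulnb andbC.
Qed.

Lemma subword_count_occ n l (w : n.-tuple bool) (u : l.-tuple bool) :
  subword_count w u = occ (nth false w) n (rev u).
Proof.
rewrite -mask_count_occ /subword_count -sum1dep_card big_mkcond /=.
pose h (m : n.-tuple bool) := [set i : 'I_n | tnth m i]%SET.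
have hbij : bijective h.
  exists (fun S : {set 'I_n} => [tuple i \in S | i < n]).
    by move=> m; apply: eq_from_tnth => i; rewrite tnth_mktuple inE.
  by move=> S; apply/setP => i; rewrite inE tnth_mktuple.
rewrite (reindex h) /=; last exact: onW_bij.
apply: eq_bigr => m _.
suff -> : [seq tnth w i | i <- enum (h m)] = mask m (mkseq (nth false w) n).
  by case: (_ == _).
have -> : mkseq (nth false w) n = w.
  by rewrite -[X in mkseq _ X](size_tuple w) mkseq_nth.
rewrite /enum_mem filter_mask map_mask -enumT map_tnth_enum; congr (mask _ _).
rewrite -[RHS]map_tnth_enum; apply: eq_map => i.
by rewrite /= inE.
Qed.

End Occurrences.

(** * Induced walks in the Cayley digraph *)

Section Walks.
Local Open Scope nat_scope.
Local Open Scope set_scope.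
Set Implicit Arguments.
Unset Strict Implicit.

Variables (n l : nat) (w : n.-tuple bool) (u : l.-tuple bool).

(** The vertices [v] are visited with the step lengths [t], where the letter of
    position [i] is that of the step of length [i.+1]. *)
Definition steps (v : l.+1.-tuple 'I_(2 * n)) (t : l.-tuple 'I_n) :=
  [forall k : 'I_l, tnth v (lift ord0 k) ==
     (tnth v (widen_ord (leqnSn l) k) + (tnth t k).+1) %% (2 * n) :> nat].

Definition positions : {set l.-tuple 'I_n} :=
  [set t : l.-tuple 'I_n | sorted ltn [seq val i | i <- t]
                           & [seq tnth w i | i <- t] == u].

Lemma card_positions : #|positions| = subword_count w u.
Proof.
pose f (t : l.-tuple 'I_n) : {set 'I_n} := [set i in t].
have enum_f (t : l.-tuple 'I_n) :
    sorted ltn [seq val i | i <- t] -> enum (f t) = t :> seq _.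
  move=> t_sorted; apply: (inj_map val_inj).
  apply: (@irr_sorted_eq _ ltn) => //.
  - exact: ltn_trans.
  - exact: ltnn.
  - rewrite sorted_map /enum_mem -enumT.
    apply: sorted_filter; first by move=> x y z; exact: ltn_trans.
    by rewrite -(@sorted_map _ _ val) val_enum_ord iota_ltn_sorted.
  - by apply: eq_mem_map => i; rewrite mem_enum inE.
rewrite /subword_count -(@card_in_imset _ _ f positions); last first.
  move=> s t; rewrite !inE => /andP[s_sorted _] /andP[t_sorted _] fst.
  by apply: val_inj; rewrite /= -(enum_f s) // fst enum_f.
apply: eq_card => S; rewrite [RHS]inE; apply/imsetP/idP => [[t]|Su].
  by rewrite inE => /andP[t_sorted tu] ->; rewrite enum_f.
have szS : size (enum S) == l.
  by rewrite -(size_tuple u) -(eqP Su) size_map.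
exists (Tuple szS); last by apply/setP => i; rewrite inE /= mem_enum.
rewrite inE /= Su andbT sorted_map /enum_mem -enumT.
apply: sorted_filter; first by move=> x y z; exact: ltn_trans.
by rewrite -(@sorted_map _ _ val) val_enum_ord iota_ltn_sorted.
Qed.

(** The lengths lie in [1, n] and the modulus is [2 * n], so no two of them are
    congruent. This is what makes walks correspond to subwords. *)
Lemma step_uniq (x : nat) (i j : 'I_n) :
  (x + i.+1) %% (2 * n) = (x + j.+1) %% (2 * n) -> i = j.
Proof.
move=> /eqP; rewrite eqn_modDl => /eqP.
have := ltn_ord i; have := ltn_ord j => jn iN.
by rewrite !modn_small => [[] /val_inj //||]; lia.
Qed.

Lemma steps_inj (v : l.+1.-tuple 'I_(2 * n)) (s t : l.-tuple 'I_n) :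
  steps v s -> steps v t -> s = t.
Proof.
move=> /forallP vs /forallP vt; apply: eq_from_tnth => k.
by apply: (@step_uniq (tnth v (widen_ord (leqnSn l) k)));
  rewrite -(eqP (vs k)) -(eqP (vt k)).
Qed.

(** Whether a step follows an edge depends on its length only, because no other
    length leads to the same vertex. *)
Lemma walk_edge (x y : 'I_(2 * n)) (i : 'I_n) :
  y = (x + i.+1) %% (2 * n) :> nat -> cayley_edge w x y = tnth w i.
Proof.
move=> yE; apply/existsP/idP => [[j /andP[wj /eqP yj]]|wi]; last first.
  by exists i; rewrite wi yE eqxx.
by rewrite (@step_uniq x i j) // -yE.
Qed.

Lemma induced_walkE v :
  induced_walk w u v = [exists t, (t \in positions) && steps v t].
Proof.
apply: eq_existsb => t; rewrite inE -andbA -[[forall k, _ == _ %% _]]/(steps v t).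
congr (_ && _); rewrite andbC.
case vt: (steps v t); rewrite ?andbF // !andbT.
have edgeE k := walk_edge (eqP (forallP vt k)).
apply/forallP/eqP => [uE|uE k].
  rewrite -[RHS]map_tnth_enum -[tval t]map_tnth_enum -map_comp.
  by apply: eq_map => k /=; rewrite -edgeE (eqP (uE k)).
rewrite edgeE (tnth_nth false u) -uE (nth_map (tnth t k)) ?size_tuple //.
by rewrite -tnth_nth.
Qed.

(** The pairs of a walk and its step lengths project injectively to walks, and
    also to pairs of a first vertex and step lengths; the second projection
    has full image, as the other vertices are partial sums of lengths. *)
Lemma induced_walk_countE :
  induced_walk_count w u = 2 * n * subword_count w u.
Proof.
pose P := [set p : l.+1.-tuple 'I_(2 * n) * l.-tuple 'I_n
             | (p.2 \in positions) && steps p.1 p.2].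
have PE p : (p \in P) = (p.2 \in positions) && steps p.1 p.2 by rewrite finset.in_set.
transitivity #|P|.
  rewrite /induced_walk_count -(@card_in_imset _ _ fst P); last first.
    move=> [v s] [v' t]; rewrite !PE /= => /andP[_ vs] /andP[_ vt] vv'.
    by rewrite vv' in vs *; rewrite (steps_inj vs vt).
  apply: eq_card => v; rewrite finset.in_set induced_walkE; apply/existsP/imsetP.
    by move=> [t Pvt]; exists (v, t); rewrite ?PE.
  by move=> [[v' t]]; rewrite PE /= => Pvt ->; exists t.
rewrite -card_positions -[in RHS](card_ord (2 * n)) -cardsT -cardsX.
rewrite -(@card_in_imset _ _ (fun p => (thead p.1, p.2)) P); last first.
  move=> [v s] [v' t]; rewrite !PE /= => /andP[_ /forallP vs] /andP[_ /forallP vt].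
  case=> v0 st; subst t; congr (_, _); apply: eq_from_tnth => -[k kl].
  elim: k kl => [|k IH] kl.
    by have -> : Ordinal kl = ord0 by exact: val_inj.
  have -> : Ordinal kl = lift ord0 (Ordinal (kl : k < l)) by exact: val_inj.
  apply: val_inj; rewrite /= (eqP (vs _)) (eqP (vt _)).
  have kl' : k < l.+1 by exact: ltnW.
  have -> : widen_ord (leqnSn l) (Ordinal (kl : k < l)) = Ordinal kl'.
    exact: val_inj.
  by rewrite IH.
apply: eq_card => -[x t]; rewrite finset.in_setX finset.in_setT /=; apply/imsetP/idP.
  by move=> [[v s]]; rewrite PE => /andP[sP _] [_ ->].
move=> tP.
have n2_gt0 : 0 < 2 * n by exact: leq_ltn_trans (ltn_ord x).
(* The vertex after [k] steps is [x] plus the first [k] lengths. *)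
pose v := [tuple Ordinal (ltn_pmod (x + \sum_(i < l | i < k) (tnth t i).+1) n2_gt0)
            | k < l.+1].
exists (v, t).
  rewrite PE /= tP; apply/forallP => k; apply/eqP; rewrite !tnth_mktuple /=.
  rewrite modnDml -addnA; congr ((_ + _) %% _).
  rewrite (bigD1 k) /=; last by rewrite /bump.
  rewrite addnC; congr (_ + _); apply: eq_bigl => i.
  by rewrite /bump /= add1n ltnS (leq_eqVlt i k) -(inj_eq val_inj) /=; lia.
congr (_, _); apply: val_inj; rewrite /thead tnth_mktuple /= big_pred0 //.
by rewrite addn0 modn_small.
Qed.

End Walks.

(** * Summation by parts, counts and partial sums of one word *)

Section Discrepancy.
Set Implicit Arguments.
Unset Strict Implicit.

Variable R : realType.

Arguments occ : simpl never.

Lemma abel_sum (x g : nat -> R) m :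
  \sum_(i < m) x i * g i =
  (\sum_(i < m) x i) * g m
  - \sum_(i < m) (\sum_(j < i.+1) x j) * (g i.+1 - g i).
Proof.
elim: m => [|m IH]; first by rewrite !big_ord0 mul0r subrr.
by rewrite !(big_ord_recr m) /= IH; ring.
Qed.

(** Small prefix sums of [x] make the sums of [x] against a weight [g] of bounded
    variation small. All uses of the discrepancy go through this bound. *)
Lemma abel_bound (x g : nat -> R) m (D : R) :
  (forall k, (k <= m)%N -> `|\sum_(i < k) x i| <= D) ->
  `|\sum_(i < m) x i * g i| <= D * (`|g m| + \sum_(i < m) `|g i.+1 - g i|).
Proof.
move=> xD; rewrite abel_sum; apply: le_trans (ler_normB _ _) _.
rewrite mulrDr lerD //; first by rewrite normrM ler_wpM2r // xD.
rewrite mulr_sumr; apply: le_trans (ler_norm_sum _ _ _) _.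
by apply: ler_sum => i _; rewrite normrM ler_wpM2r // xD.
Qed.

Definition letter_weight (d : R) (b : bool) : R := if b then d else 1 - d.

(** The probability of the word [u] when its letters are independent and equal
    to 1 with probability [d]. *)
Definition word_weight (d : R) (u : seq bool) : R :=
  \prod_(b <- u) letter_weight d b.

Lemma word_weightE (d : R) l (u : l.-tuple bool) :
  d ^+ ones u * (1 - d) ^+ (l - ones u) = word_weight d u.
Proof.
have onesE : ones u = count id u.
  rewrite /ones -sum1_count [RHS]big_mkcond /= big_tuple.
  by apply: eq_bigr => i _; case: (tnth u i).
have := size_tuple u; rewrite onesE; move: (tval u) => s <-.
elim: s => [|b s IH] /=; first by rewrite /word_weight big_nil mulr1.
rewrite /word_weight big_cons -/(word_weight d s) -IH.
have := count_size id s; move: (count id s) => k ks.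
case: b => /=; first by rewrite add1n subSS exprS mulrA.
by rewrite add0n subSn // exprS mulrCA.
Qed.

Lemma word_weight_rev (d : R) (u : seq bool) :
  word_weight d (rev u) = word_weight d u.
Proof. by apply: perm_big; rewrite perm_rev. Qed.

Lemma word_weight01 (d : R) (u : seq bool) :
  0 <= d <= 1 -> 0 <= word_weight d u <= 1.
Proof.
move=> /andP[d0 d1]; elim: u => [|b u /andP[u0 u1]].
  by rewrite /word_weight big_nil ler01 lexx.
rewrite /word_weight big_cons -/(word_weight d u).
have b01 : 0 <= letter_weight d b <= 1 by case: b => /=; lra.
by case/andP: b01 => b0 b1; rewrite mulr_ge0 //= mulr_ile1.
Qed.

Lemma hockey_stick m l : (\sum_(j < m) 'C(j, l))%N = 'C(m, l.+1).
Proof.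
by elim: m => [|m IH]; rewrite ?big_ord0 // big_ord_recr /= IH binS.
Qed.

Lemma bin_le_exp m l : ('C(m, l) <= m ^ l)%N.
Proof.
elim: l m => [|l IH] m; first by rewrite bin0.
rewrite -hockey_stick expnS -[X in (X * _)%N]card_ord -sum_nat_const.
apply: leq_sum => j _; apply: leq_trans (IH j) _; case: (l) => // k.
by rewrite leq_exp2r // ltnW.
Qed.

(** One more letter replaces the error [2 * l * e * n ^ l] by [n] times itself,
    one copy for each position of the new letter, plus [2 * e * n ^ l.+1]: the
    discrepancy of [w] against the weight [C(j, l)], which increases from at
    least 0 to at most [n ^ l]. *)
Lemma occ_uniform (d e : R) (w : nat -> bool) n : 0 <= d <= 1 -> 0 <= e ->
  (forall k, (k <= n)%N -> `|\sum_(i < k) ((w i)%:R - d)| <= e * n%:R) ->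
  forall (u : seq bool) m, (m <= n)%N ->
  `|(occ w m u)%:R - word_weight d u * 'C(m, size u)%:R|
  <= (2 * size u)%:R * e * n%:R ^+ size u.
Proof.
move=> d01 e0 we; elim=> [|b u IH] m mn.
  by rewrite occ_nil /word_weight big_nil bin0 mul1r subrr normr0 muln0 !mul0r.
set l := size u in IH *; set c := word_weight d u in IH *.
have [c0 c1] := andP (word_weight01 u d01); rewrite -/c in c0 c1.
have -> : word_weight d (b :: u) = letter_weight d b * c.
  by rewrite /word_weight big_cons.
have -> : (occ w m (b :: u))%:R - letter_weight d b * c * 'C(m, l.+1)%:R =
    \sum_(j < m) (w j == b)%:R * ((occ w j u)%:R - c * 'C(j, l)%:R)
    + (-1) ^+ (~~ b) * c * (\sum_(j < m) ((w j)%:R - d) * 'C(j, l)%:R).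
  rewrite /occ -/(occ w) big_mkcond /= natr_sum -hockey_stick natr_sum !mulr_sumr.
  rewrite -sumrB -big_split /=; apply: eq_bigr => j _.
  by case: b; case: (w j) => /=; ring.
apply: le_trans (ler_normD _ _) _.
have -> : (2 * l.+1)%:R * e * n%:R ^+ l.+1 =
    n%:R * ((2 * l)%:R * e * n%:R ^+ l) + e * n%:R * (n%:R ^+ l + n%:R ^+ l) :> R.
  by rewrite exprS mulnS natrD; ring.
apply: lerD.
  apply: le_trans (ler_norm_sum _ _ _) _.
  apply: (@le_trans _ _ (\sum_(j < m) ((2 * l)%:R * e * n%:R ^+ l))).
    apply: ler_sum => j _.
    have jn : (j <= n)%N by rewrite (leq_trans (ltnW (ltn_ord j))).
    rewrite normrM; apply: le_trans (IH j jn).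
    by rewrite ler_piMl // normr_nat lern1 leq_b1.
  rewrite sumr_const card_ord -[leLHS]mulr_natl ler_wpM2r ?ler_nat //.
  by rewrite !mulr_ge0 // exprn_ge0.
rewrite normrM normrM normrX normrN1 expr1n mul1r (ger0_norm c0).
apply: (@le_trans _ _ (1 * (e * n%:R * (n%:R ^+ l + n%:R ^+ l))));
  last by rewrite mul1r.
apply: ler_pM => //.
apply: le_trans (@abel_bound (fun j => (w j)%:R - d) (fun j => 'C(j, l)%:R) m _ _) _.
  by move=> k km; apply: we; exact: leq_trans km mn.
have bin_n : 'C(m, l)%:R <= n%:R ^+ l :> R.
  rewrite -natrX ler_nat (leq_trans (bin_le_exp m l)) //.
  by case: (l) => // l'; rewrite leq_exp2r.
rewrite ler_wpM2l ?mulr_ge0 // lerD ?normr_nat //.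
under eq_bigr => j _ do rewrite -natrB ?leq_bin2l // normr_nat natrB ?leq_bin2l //.
rewrite -(big_mkord xpredT (fun j => 'C(j.+1, l)%:R - 'C(j, l)%:R)).
by rewrite telescope_sumr // lerBlDr (le_trans bin_n) // lerDl.
Qed.

(** The second moment of a prefix sum involves pairs [i < j] only, plus a
    diagonal that is of lower order when [x] is bounded. *)
Lemma sum_sqr_prefix (x : nat -> R) k :
  (\sum_(i < k) x i) ^+ 2 =
  2 * (\sum_(j < k) x j * \sum_(i < j) x i) + \sum_(j < k) x j ^+ 2.
Proof.
elim: k => [|k IH]; first by rewrite !big_ord0 expr0n mulr0 addr0.
by rewrite !(big_ord_recr k) /= sqrrD IH; ring.
Qed.

(** The left side is a sum over [i < j < k] that ignores the letter at [k], so
    each letter [a] there has coefficient 1. This is why patterns of length 3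
    are enough. *)
Lemma centered_occ3 (d : R) (w : nat -> bool) n :
  let x b : R := b%:R - d in
  \sum_(k < n) \sum_(j < k) x (w j) * \sum_(i < j) x (w i) =
  \sum_(a : bool) \sum_(b : bool) \sum_(c : bool)
     x b * x c * (occ w n [:: a; b; c])%:R.
Proof.
move=> x.
have occ1 m : \sum_(i < m) x (w i) =
    x true * (occ w m [:: true])%:R + x false * (occ w m [:: false])%:R.
  elim: m => [|m IH]; first by rewrite !occ0 !big_ord0 !mulr0 addr0.
  by rewrite big_ord_recr /= IH !occS !occ_nil !natrD; case: (w m) => /=; ring.
have occ2 m : \sum_(j < m) x (w j) * \sum_(i < j) x (w i) =
    \sum_(b : bool) \sum_(c : bool) x b * x c * (occ w m [:: b; c])%:R.
  rewrite !big_bool /=.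
  elim: m => [|m IH]; first by rewrite !occ0 !big_ord0 !mulr0 !addr0.
  rewrite big_ord_recr /= IH occ1 !occS !natrD !natrM.
  by case: (w m) => /=; ring.
rewrite !big_bool /=.
elim: n => [|n IH]; first by rewrite !occ0 !big_ord0 !mulr0 !addr0.
rewrite big_ord_recr /= IH occ2 !big_bool /= !occS !natrD !natrM.
by case: (w n) => /=; ring.
Qed.

(** Cubes are compared rather than the numbers themselves so that the variation of
    the cube is controlled by the square. *)
Lemma cube_variation (a b : R) : 0 <= a -> 0 <= b -> `|a - b| <= 1 ->
  `|a ^+ 3 - b ^+ 3| <= 6 * b ^+ 2 + 4.
Proof.
move=> a0 b0 ab1.
have -> : a ^+ 3 - b ^+ 3 = (a - b) * (a ^+ 2 + a * b + b ^+ 2) by ring.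
have p0 : 0 <= a ^+ 2 + a * b + b ^+ 2 by rewrite !addr_ge0 ?mulr_ge0 ?exprn_ge0.
rewrite normrM (ger0_norm p0); apply: le_trans (_ : 1 * _ <= _).
  exact: ler_wpM2r ab1.
have ab : a <= b + 1 by have := ler_norm (a - b); lra.
have a2 : a ^+ 2 <= (b + 1) ^+ 2 by rewrite lerXn2r ?nnegrE ?addr_ge0.
have abb : a * b <= (b + 1) * b by rewrite ler_wpM2r.
by have := sqr_ge0 (b - 1); rewrite !expr2 in a2 *; lra.
Qed.

(** The variation of [|T| ^ 3] along the whole range is at most
    [6 * A + 4 * n] by [cube_variation]; so [|T m| ^ 3] exceeds its average,
    which is at most [2 * A], by at most that amount. *)
Lemma sup_from_mean_square (T : nat -> R) n (A : R) : (0 < n)%N ->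
  (forall k, (k < n)%N -> `|T k.+1 - T k| <= 1) ->
  (forall k, (k <= n)%N -> `|T k| <= 2 * n%:R) ->
  \sum_(k < n) T k ^+ 2 <= A ->
  forall m, (m <= n)%N -> `|T m| ^+ 3 <= 8 * A + 4 * n%:R.
Proof.
move=> n0 T1 Tn TA m mn.
pose h k := 6 * T k ^+ 2 + 4.
have h0 k : 0 <= h k by rewrite /h; have := sqr_ge0 (T k); lra.
have tele i k : (i <= k <= n)%N ->
    `| `|T k| ^+ 3 - `|T i| ^+ 3 | <= \sum_(j < n) h j.
  move=> /andP[ik kn].
  rewrite -(telescope_sumr (fun j => `|T j| ^+ 3) ik).
  apply: le_trans (ler_norm_sum _ _ _) _.
  rewrite -(big_mkord xpredT h) [leRHS](big_cat_nat (leq0n i)) /=; last first.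
    exact: leq_trans kn.
  rewrite [X in _ + X](big_cat_nat ik kn) /= addrCA.
  rewrite -[leLHS]addr0 lerD ?addr_ge0 ?sumr_ge0 //.
  rewrite big_nat [leRHS]big_nat; apply: ler_sum => j /andP[_ jk].
  rewrite /h -real_normK ?num_real //; apply: cube_variation => //.
  by rewrite (le_trans (ler_dist_dist _ _)) // T1 // (leq_trans jk kn).
have diff i : (i <= n)%N -> `|T m| ^+ 3 <= `|T i| ^+ 3 + \sum_(j < n) h j.
  move=> iN; case: (leqP i m) => im.
    have := tele i m; rewrite im mn => /(_ isT) /(le_trans (ler_norm _)); lra.
  have := tele m i; rewrite (ltnW im) iN => /(_ isT).
  by rewrite distrC => /(le_trans (ler_norm _)); lra.
have sumh : \sum_(j < n) h j = 6 * \sum_(j < n) T j ^+ 2 + 4 * n%:R.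
  by rewrite big_split /= -mulr_sumr sumr_const card_ord mulr_natr.
have n0' : 0 < n%:R :> R by rewrite ltr0n.
have avg : n%:R * `|T m| ^+ 3 <=
    2 * n%:R * (\sum_(i < n) T i ^+ 2) + n%:R * \sum_(j < n) h j.
  have -> : n%:R * `|T m| ^+ 3 = \sum_(i < n) `|T m| ^+ 3.
    by rewrite sumr_const card_ord mulr_natl.
  have -> : n%:R * \sum_(j < n) h j = \sum_(i < n) \sum_(j < n) h j.
    by rewrite sumr_const card_ord mulr_natl.
  rewrite mulr_sumr -big_split /=; apply: ler_sum => i _.
  apply: le_trans (diff i (ltnW (ltn_ord i))) _; rewrite lerD2r.
  by rewrite exprS real_normK ?num_real // ler_wpM2r ?sqr_ge0 // Tn // ltnW.
have : n%:R * `|T m| ^+ 3 <= n%:R * (8 * \sum_(i < n) T i ^+ 2 + 4 * n%:R).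
  by apply: le_trans avg _; rewrite sumh; lra.
rewrite ler_pM2l // => /le_trans; apply.
by rewrite lerD2r ler_pM2l.
Qed.

End Discrepancy.

(** * Uniformity, subword counts and walks *)

Section Asymptotics.
Set Implicit Arguments.
Unset Strict Implicit.

Variables (R : realType) (d : R).

Definition prefix_disc n (w : n.-tuple bool) (m : nat) : R :=
  \sum_(i < m) ((nth false w i)%:R - d).

Definition balanced (w : forall n, n.-tuple bool) : Prop :=
  forall e : R, 0 < e -> \forall n \near \oo,
    forall m, (m <= n)%N -> `|prefix_disc (w n) m| <= e * n%:R.

Lemma eqaddo_seqP (f g h : nat -> R) :
  f = g +o_\oo h <->
  forall e : R, 0 < e -> \forall n \near \oo, `|f n - g n| <= e * `|h n|.
Proof. exact: eqaddoP. Qed.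

Lemma interval_disc n (w : n.-tuple bool) a b : (a <= b <= n)%N ->
  let I := [set i : 'I_n | (a <= i < b)%N]%SET in
  \sum_(i in I) (tnth w i)%:R - d * #|I|%:R = prefix_disc w b - prefix_disc w a.
Proof.
move=> /andP[ab bn] I.
have -> : \sum_(i in I) (tnth w i)%:R - d * #|I|%:R =
    \sum_(i < n | (a <= i < b)%N) ((nth false w i)%:R - d).
  rewrite sumrB sumr_const mulr_natr; congr (_ - _ *+ _).
    apply: eq_big => [i|i _]; first by rewrite inE.
    by rewrite (tnth_nth false).
  by apply: eq_card => i; rewrite inE.
rewrite /prefix_disc -(big_mkord (fun i => (a <= i < b)%N)
  (fun i => (nth false w i)%:R - d)).
rewrite -!(big_mkord xpredT (fun i => (nth false w i)%:R - d)).
rewrite [in RHS](big_cat_nat (leq0n a) ab) /= [RHS]addrAC subrr add0r.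
rewrite (big_nat_widenl a 0) // (big_nat_widen 0 b n) //.
Qed.

Lemma uniform_balanced w : uniform_seq d w <-> balanced w.
Proof.
split=> [[eps eps0 weps] e e_gt0|wb].
  have : \forall n \near \oo, `|eps n| <= e.
    move/cvgrPdist_le: eps0 => /(_ _ e_gt0).
    by apply: filterS => n; rewrite sub0r normrN.
  apply: filterS => n epsn m mn.
  have := weps n [set i : 'I_n | (0 <= i < m)%N]%SET.
  rewrite interval_disc ?mn // {2}/prefix_disc big_ord0 subr0 => disc.
  apply: le_trans (disc _) _; first by exists 0%N, m.
  by rewrite ler_wpM2r // (le_trans (ler_norm _)).
pose D n := \big[Num.max/0]_(m < n.+1) `|prefix_disc (w n) m|.
have D_ge n m : (m <= n)%N -> `|prefix_disc (w n) m| <= D n.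
  by move=> mn; exact: (le_bigmax _ _ (Ordinal (mn : (m < n.+1)%N))).
have D_ge0 n : 0 <= D n.
  by apply: le_trans (D_ge n 0%N _).
(* The factor 2 accounts for an interval being a difference of prefixes. *)
exists (fun n => 2 * D n / n%:R).
  apply/cvgrPdist_le => e e_gt0.
  near=> n.
  have n_gt0 : 0 < n%:R :> R by rewrite ltr0n; near: n; exact: nbhs_infty_gt.
  rewrite sub0r normrN ger0_norm ?divr_ge0 ?mulr_ge0 //.
  rewrite ler_pdivrMr // mulrC -ler_pdivlMr // mulrAC.
  apply: bigmax_le => [|m _]; first by rewrite !mulr_ge0 ?invr_ge0 // ltW.
  have mn : (m <= n)%N by rewrite -ltnS.
  move: (m : nat) mn; near: n; apply: wb; rewrite divr_gt0 //.
move=> n _ [a [b ->]].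
case: (posnP n) => [n0|n_gt0].
  subst n; rewrite mulr0 big1 ?sub0r; last by case.
  by rewrite [#|_|](_ : _ = 0%N) ?mulr0 ?oppr0 ?normr0 //; apply: eq_card0; case.
have -> : [set i : 'I_n | (a <= i < b)%N]%SET =
    [set i : 'I_n | (minn a (minn b n) <= i < minn b n)%N]%SET.
  apply/setP => i; rewrite !inE; have := ltn_ord i; lia.
rewrite interval_disc ?geq_minr //.
rewrite divfK ?pnatr_eq0 -?lt0n //.
apply: le_trans (ler_normB _ _) _; rewrite mulr2n mulrDl mul1r.
by rewrite lerD // D_ge // ?geq_minr // (leq_trans (geq_minr _ _)) ?geq_minr.
Unshelve. all: by end_near. Qed.

Lemma balanced_counting w : 0 <= d <= 1 -> balanced w ->
  forall l (u : l.-tuple bool),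
    (fun n => (subword_count (w n) u)%:R : R) =
    (fun n => d ^+ ones u * (1 - d) ^+ (l - ones u) * 'C(n, l)%:R)
      +o_\oo (fun n => n%:R ^+ l : R).
Proof.
move=> d01 wb l u; apply/eqaddo_seqP => e e_gt0.
have e'_gt0 : 0 < e / (2 * l).+1%:R by rewrite divr_gt0.
apply: filterS (wb _ e'_gt0) => n wn.
rewrite word_weightE subword_count_occ -word_weight_rev.
have := occ_uniform d01 (ltW e'_gt0) wn (rev u) (leqnn n).
rewrite size_rev size_tuple => /le_trans; apply.
rewrite (ger0_norm (exprn_ge0 _ _)) // ler_wpM2r ?exprn_ge0 //.
rewrite mulrCA ler_piMr ?(ltW e_gt0) // ler_pdivrMr // mul1r ler_nat.
exact: leqnSn.
Qed.

(** The eight patterns enter the mean square of the discrepancy with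
    coefficients [(b - d) * (c - d)], and the main terms cancel because a letter
    of density [d] has mean [d]. *)
Lemma minimizer_balanced (w : forall n, n.-tuple bool) : 0 <= d <= 1 ->
  (forall u : 3.-tuple bool,
    (fun n => (subword_count (w n) u)%:R : R) =
    (fun n => d ^+ ones u * (1 - d) ^+ (3 - ones u) * 'C(n, 3)%:R)
      +o_\oo (fun n => n%:R ^+ 3 : R)) ->
  balanced w.
Proof.
move=> d01 wmin e e_gt0.
have d0 : 0 <= d by case/andP: d01.
have d1 : d <= 1 by case/andP: d01.
(* With error [eta * n ^ 3] for each count, the mean square sums to at most
   [16 * eta * n ^ 3 + n ^ 2], and the cube of the discrepancy is at most
   [128 * eta * n ^ 3 + 8 * n ^ 2 + 4 * n]. *)
pose eta : R := e ^+ 3 / 16 / 16.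
have eta_gt0 : 0 < eta by rewrite !divr_gt0 ?exprn_gt0.
have : \forall n \near \oo, forall u : 3.-tuple bool,
    `|(subword_count (w n) u)%:R - word_weight d u * 'C(n, 3)%:R|
      <= eta * n%:R ^+ 3.
  apply: filter_forall => u.
  have /eqaddo_seqP/(_ _ eta_gt0) := wmin u.
  apply: filterS => n; rewrite word_weightE.
  by rewrite (ger0_norm (exprn_ge0 _ _)).
move=> wn0; near=> n.
have wn a b c : `|(occ (nth false (w n)) n [:: a; b; c])%:R
    - word_weight d [:: a; b; c] * 'C(n, 3)%:R| <= eta * n%:R ^+ 3.
  have wn' : forall u : 3.-tuple bool,
    `|(subword_count (w n) u)%:R - word_weight d u * 'C(n, 3)%:R|
      <= eta * n%:R ^+ 3.
    by near: n.
  have := wn' [tuple c; b; a].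
  by rewrite subword_count_occ -(word_weight_rev d [tuple c; b; a]).
have n_ge : 24 * e ^- 3 + 1 <= n%:R :> R by near: n; exact: nbhs_infty_ger.
have e3 : 0 < e ^+ 3 by rewrite exprn_gt0.
have n_ge1 : 1 <= n%:R :> R.
  by apply: le_trans n_ge; rewrite lerDr mulr_ge0 // invr_ge0 ltW.
have n_gt0 : (0 < n)%N by rewrite -(ltr0n R); exact: lt_le_trans n_ge1.
pose x i : R := (nth false (w n) i)%:R - d.
have x1 i : `|x i| <= 1 by rewrite /x ler_norml; case: (nth _ _ _) => /=; lra.
have T1 k : `|prefix_disc (w n) k.+1 - prefix_disc (w n) k| <= 1.
  by rewrite /prefix_disc big_ord_recr /= addrAC subrr add0r; exact: x1.
have Tn k : (k <= n)%N -> `|prefix_disc (w n) k| <= 2 * n%:R.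
  move=> kn; apply: (@le_trans _ _ k%:R).
    rewrite -[X in X%:R]card_ord -sumr_const.
    by apply: le_trans (ler_norm_sum _ _ _) _; apply: ler_sum => i _; exact: x1.
  have : k%:R <= n%:R :> R by rewrite ler_nat.
  lra.
have Q : \sum_(k < n) \sum_(j < k) x j * \sum_(i < j) x i <= 8 * (eta * n%:R ^+ 3).
  rewrite (centered_occ3 d (nth false (w n))).
  pose y (b : bool) : R := b%:R - d.
  have y1 b : `|y b| <= 1 by rewrite /y ler_norml; case: b => /=; lra.
  have -> : \sum_(a : bool) \sum_(b : bool) \sum_(c : bool)
        y b * y c * (occ (nth false (w n)) n [:: a; b; c])%:R =
      \sum_(a : bool) \sum_(b : bool) \sum_(c : bool)
        y b * y c * ((occ (nth false (w n)) n [:: a; b; c])%:R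
          - word_weight d [:: a; b; c] * 'C(n, 3)%:R).
    rewrite !big_bool /word_weight !big_cons big_nil /y /=; ring.
  have -> : 8 * (eta * n%:R ^+ 3) = \sum_(a : bool) \sum_(b : bool)
      \sum_(c : bool) eta * n%:R ^+ 3 by rewrite !big_bool /=; ring.
  apply: ler_sum => a _; apply: ler_sum => b _; apply: ler_sum => c _.
  apply: le_trans (ler_norm _) (le_trans _ (wn a b c)).
  rewrite [leLHS]normrM ler_piMl // normrM.
  by rewrite mulr_ile1.
have sq : \sum_(k < n) prefix_disc (w n) k ^+ 2
    <= 16 * (eta * n%:R ^+ 3) + n%:R ^+ 2.
  rewrite /prefix_disc; under eq_bigr => k _ do rewrite (sum_sqr_prefix x).
  rewrite big_split /= -mulr_sumr lerD //.
    have -> : 16 * (eta * n%:R ^+ 3) = 2 * (8 * (eta * n%:R ^+ 3)) by ring.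
    by rewrite ler_pM2l.
  rewrite expr2 -[X in X%:R * _]card_ord mulr_natl -sumr_const.
  apply: ler_sum => k _; apply: (@le_trans _ _ k%:R); last by rewrite ler_nat ltnW.
  rewrite -[X in X%:R]card_ord -sumr_const; apply: ler_sum => i _.
  by rewrite -real_normK ?num_real // expr_le1.
move=> m mn.
have := sup_from_mean_square n_gt0 (fun k _ => T1 k) Tn sq mn.
move=> disc3; rewrite -(@ler_pXn2r _ 3) ?nnegrE ?mulr_ge0 ?(ltW e_gt0) //.
apply: le_trans disc3 _; rewrite exprMn /eta.
have en : 24 <= e ^+ 3 * n%:R.
  by rewrite mulrC -ler_pdivrMr //; apply: le_trans n_ge; rewrite lerDl.
have : 24 * n%:R ^+ 2 <= e ^+ 3 * n%:R * n%:R ^+ 2.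
  by rewrite ler_wpM2r // exprn_ge0.
have : n%:R <= n%:R ^+ 2 :> R by rewrite expr2 ler_peMr.
rewrite -mulrA -exprS; lra.
Unshelve. all: by end_near. Qed.

Lemma cayley_minimizer (w : forall n, n.-tuple bool) :
  (forall u : 3.-tuple bool,
    (fun n => (induced_walk_count (w n) u)%:R : R) =
    (fun n => d ^+ ones u * (1 - d) ^+ (3 - ones u) * (2 * n%:R * 'C(n, 3)%:R))
      +o_\oo (fun n => n%:R ^+ 4 : R)) <->
  (forall u : 3.-tuple bool,
    (fun n => (subword_count (w n) u)%:R : R) =
    (fun n => d ^+ ones u * (1 - d) ^+ (3 - ones u) * 'C(n, 3)%:R)
      +o_\oo (fun n => n%:R ^+ 3 : R)).
Proof.
have walkE n (u : 3.-tuple bool) :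
    (induced_walk_count (w n) u)%:R
    - d ^+ ones u * (1 - d) ^+ (3 - ones u) * (2 * n%:R * 'C(n, 3)%:R)
    = 2 * n%:R * ((subword_count (w n) u)%:R
        - d ^+ ones u * (1 - d) ^+ (3 - ones u) * 'C(n, 3)%:R) :> R.
  by rewrite induced_walk_countE !natrM; ring.
split=> H u; apply/eqaddo_seqP => e e_gt0.
  have /eqaddo_seqP/(_ _ e_gt0) := H u.
  move=> Hn; near=> n.
  have n_gt0 : 0 < n%:R :> R by rewrite ltr0n; near: n; exact: nbhs_infty_gt.
  have : `|(induced_walk_count (w n) u)%:R
    - d ^+ ones u * (1 - d) ^+ (3 - ones u) * (2 * n%:R * 'C(n, 3)%:R)|
    <= e * `|n%:R ^+ 4| by near: n.
  rewrite walkE normrM (ger0_norm (mulr_ge0 _ _)) //.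
  rewrite !(ger0_norm (exprn_ge0 _ _)) //.
  set D := `|(subword_count (w n) u)%:R - _|; have D0 : 0 <= D by exact: normr_ge0.
  have -> : 2 * n%:R * D = n%:R * (2 * D) by ring.
  have -> : e * n%:R ^+ 4 = n%:R * (e * n%:R ^+ 3) by ring.
  by rewrite ler_pM2l //; lra.
have e2_gt0 : 0 < e / 2 by rewrite divr_gt0.
have /eqaddo_seqP/(_ _ e2_gt0) := H u.
apply: filterS => n Hn; rewrite walkE normrM (ger0_norm (mulr_ge0 _ _)) //.
rewrite !(ger0_norm (exprn_ge0 _ _)) // in Hn *.
apply: le_trans (_ : 2 * n%:R * (e / 2 * n%:R ^+ 3) <= _).
  by rewrite ler_wpM2l ?mulr_ge0.
by rewrite exprS le_eqVlt; apply/orP; left; apply/eqP; field.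
Unshelve. all: by end_near. Qed.

End Asymptotics.

(** * Averages of Lipschitz functions *)

Section RiemannSums.
Set Implicit Arguments.
Unset Strict Implicit.

Variable R : realType.
Notation mu := (@lebesgue_measure R).

Definition lip_on_line (K : R) (g : R -> R) :=
  forall x y, `|g x - g y| <= K * `|x - y|.

Lemma lip_continuous K g : lip_on_line K g -> continuous g.
Proof.
move=> gK x; apply/cvgrPdist_le => e e_gt0.
have K1 : 0 < `|K| + 1 by rewrite ltr_wpDl.
near=> y; apply: le_trans (gK x y) _.
apply: le_trans (_ : (`|K| + 1) * `|x - y| <= _).
  by rewrite ler_wpM2r // (le_trans (ler_norm K)) // lerDl.
rewrite mulrC -ler_pdivlMr //.
by near: y; apply: cvgr_dist_le; [exact: cvg_id|rewrite divr_gt0].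
Unshelve. all: by end_near. Qed.

Lemma lip_integrable K g a b : lip_on_line K g ->
  mu.-integrable `[a, b[ (EFin \o g).
Proof.
move=> gK; apply: (@integrableS _ _ _ mu `[a, b]) => //.
  by apply: subset_itvl; rewrite bnd_simp.
apply: continuous_compact_integrable; first exact: segment_compact.
exact/continuous_subspaceT/(lip_continuous gK).
Qed.

Lemma cst_lip c : lip_on_line 0 (fun=> c).
Proof. by move=> x y; rewrite subrr normr0 mul0r. Qed.

Lemma Rintegral_cst_itv (a b c : R) : a <= b ->
  \int[mu]_(x in `[a, b[) c = (b - a) * c.
Proof.
move=> ab; rewrite Rintegral_cst //= lebesgue_measure_itv /= lte_fin.
case: ltP => [_|ba] /=; first by rewrite mulrC.
by rewrite mulr0 (@le_anti _ _ a b) ?ab // subrr mul0r.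
Qed.

Lemma integral_near_cst K g (a b c e : R) : lip_on_line K g -> a <= b ->
  (forall x, a <= x < b -> `|g x - c| <= e) ->
  `|\int[mu]_(x in `[a, b[) g x - (b - a) * c| <= (b - a) * e.
Proof.
move=> gK ab ge.
have gcK : lip_on_line K (fun x => g x - c).
  by move=> x y; rewrite opprB addrA subrK.
have ngcK : lip_on_line K (fun x => `|g x - c|).
  by move=> x y; apply: le_trans (gcK x y); exact: ler_dist_dist.
rewrite -!Rintegral_cst_itv // -RintegralB //=; first last.
- exact: lip_integrable (cst_lip c).
- exact: lip_integrable gK.
apply: le_trans (le_normr_Rintegral _ _) _ => //.
  exact: lip_integrable gcK.
apply: le_Rintegral => //; first exact: lip_integrable ngcK.
  exact: lip_integrable (cst_lip e).
Qed.

(** By induction on the number of cells [j / n, (j + 1) / n[ of the partition: on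
    each of them [g] is within [K / n] of its value at the right end. *)
Lemma riemann_sum_lip K g n : lip_on_line K g -> 0 <= K -> (0 < n)%N ->
  `|n%:R^-1 * \sum_(j < n) g (j.+1%:R / n%:R) - \int[mu]_(x in `[0, 1[) g x|
  <= K / n%:R.
Proof.
move=> gK K0 n0; have n0' : 0 < n%:R :> R by rewrite ltr0n.
suff H m : `|n%:R^-1 * \sum_(j < m) g (j.+1%:R / n%:R)
    - \int[mu]_(x in `[0, (m%:R / n%:R)[) g x| <= m%:R / n%:R * (K / n%:R).
  by have := H n; rewrite divff ?gt_eqF // mul1r.
elim: m => [|m IH].
  rewrite big_ord0 mulr0 !mul0r set_itv_ge ?bnd_simp ?ltxx //.
  by rewrite Rintegral_set0 subrr normr0.
have mm : m%:R / n%:R <= m.+1%:R / n%:R :> R.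
  by rewrite ler_pM2r ?invr_gt0 // ler_nat.
have m0 : 0 <= m%:R / n%:R :> R by rewrite divr_ge0.
rewrite (@itv_bndbnd_setU _ _ _ (BLeft (m%:R / n%:R))) ?bnd_simp //.
rewrite Rintegral_setU //; first last.
- rewrite disj_set2E; apply/eqP/seteqP; split => // x [] /=.
  by rewrite !in_itv /= => /andP[_ xm] /andP[/le_lt_trans/(_ xm)]; rewrite ltxx.
- rewrite -itv_bndbnd_setU ?bnd_simp //; exact: lip_integrable gK.
rewrite big_ord_recr mulrDr /=.
have dm : m.+1%:R / n%:R - m%:R / n%:R = n%:R^-1 :> R.
  by rewrite -mulrBl -natrB // subSnn mul1r.
have := @integral_near_cst K g (m%:R / n%:R) (m.+1%:R / n%:R)
  (g (m.+1%:R / n%:R)) (K / n%:R) gK mm.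
rewrite dm => loc.
have {}loc : `|n%:R^-1 * g (m.+1%:R / n%:R)
    - \int[mu]_(x in `[(m%:R / n%:R), (m.+1%:R / n%:R)[) g x|
    <= n%:R^-1 * (K / n%:R).
  rewrite distrC; apply: loc => x /andP[mx xm].
  apply: le_trans (gK _ _) _; rewrite ler_wpM2l // distrC ger0_norm; last by lra.
  by rewrite -dm; lra.
have -> : m.+1%:R / n%:R * (K / n%:R) =
    m%:R / n%:R * (K / n%:R) + n%:R^-1 * (K / n%:R).
  by rewrite -dm; ring.
rewrite opprD addrACA.
by apply: le_trans (ler_normD _ _) _; rewrite lerD.
Qed.

(** The average of [g] over the positions of ones is [d] times a Riemann sum of
    [g], plus a sum of [w_j - d] against the samples of [g], whose total
    variation is at most [K]. *)
Lemma balanced_weighted_average (d : R) (w : forall n, n.-tuple bool) K g :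
  0 <= d <= 1 ->
  balanced d w -> lip_on_line K g -> 0 <= K ->
  forall e : R, 0 < e -> \forall n \near \oo,
    `|n%:R^-1 * \sum_(j < n) (tnth (w n) j)%:R * g (j.+1%:R / n%:R)
      - d * \int[mu]_(x in `[0, 1[) g x| <= e.
Proof.
move=> /andP[d0 d1] wb gK K0 e e_gt0.
(* [B] bounds the last sample plus the total variation of the samples, in the
   notation of [abel_bound]. *)
pose B : R := `|g 0| + 3 * K + 1.
have B_gt0 : 0 < B by rewrite ltr_wpDl // addr_ge0 // mulr_ge0.
have e'_gt0 : 0 < e / 2 / B by rewrite !divr_gt0.
near=> n.
have n_gt0 : (0 < n)%N by near: n; exact: nbhs_infty_gt.
have n_gt0' : 0 < n%:R :> R by rewrite ltr0n.
have disc m : (m <= n)%N -> `|prefix_disc d (w n) m| <= e / 2 / B * n%:R.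
  by move: m; near: n; exact: wb.
have Kn : K / n%:R <= e / 2.
  by rewrite ler_pdivrMr // -ler_pdivrMl ?divr_gt0 //; near: n; exact: nbhs_infty_ger.
pose G j := g (j.+1%:R / n%:R).
have -> : \sum_(j < n) (tnth (w n) j)%:R * g (j.+1%:R / n%:R) =
    d * \sum_(j < n) G j + \sum_(j < n) ((nth false (w n) j)%:R - d) * G j.
  rewrite mulr_sumr -big_split; apply: eq_bigr => j _ /=.
  by rewrite (tnth_nth false) mulrBl addrC subrK.
rewrite mulrDr mulrCA addrAC -mulrBr.
rewrite (splitr e); apply: le_trans (ler_normD _ _) _; apply: lerD.
  rewrite normrM (ger0_norm d0); apply: le_trans Kn.
  apply: le_trans (riemann_sum_lip gK K0 n_gt0).
  by rewrite ler_piMl.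
have G1 j : `|G j.+1 - G j| <= K / n%:R.
  apply: le_trans (gK _ _) _; rewrite ler_wpM2l // -mulrBl.
  by rewrite -natrB // subSnn mul1r ger0_norm // invr_ge0 ltW.
have Gn : `|G n| <= `|g 0| + 2 * K.
  have := gK (n.+1%:R / n%:R) 0; rewrite subr0 -/(G n).
  have -> : `|n.+1%:R / n%:R| = 1 + n%:R^-1 :> R.
    rewrite ger0_norm ?divr_ge0 // -natr1 mulrDl mul1r divff ?gt_eqF //.
  have : n%:R^-1 <= 1 :> R by rewrite invf_le1 // ler1n.
  move=> n1 H; have : K * (1 + n%:R^-1) <= K * 2 by rewrite ler_wpM2l //; lra.
  have := ler_normD (G n - g 0) (g 0); rewrite subrK; lra.
have sumG : \sum_(j < n) `|G j.+1 - G j| <= K.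
  apply: le_trans (ler_sum _ (fun (j : 'I_n) _ => G1 j)) _.
  by rewrite sumr_const card_ord -[leLHS]mulr_natr divfK ?gt_eqF.
rewrite normrM normfV normr_nat ler_pdivrMl //.
apply: le_trans
  (abel_bound (x := fun j => (nth false (w n) j)%:R - d) G disc) _.
have -> : n%:R * (e / 2) = e / 2 / B * n%:R * B.
  by rewrite mulrAC mulfVK ?gt_eqF // mulrC.
rewrite ler_wpM2l // ?(mulr_ge0 (ltW e'_gt0)) //.
by apply: le_trans (lerD Gn sumG) _; rewrite /B; lra.
Unshelve. all: by end_near. Qed.

End RiemannSums.

(** * Roots of unity *)

Section UnitCircle.
Set Implicit Arguments.
Unset Strict Implicit.

Variable R : realType.

Definition cis (t : R) : R[i] := cos t +i* sin t.

Lemma cisD s t : cis (s + t) = cis s * cis t.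
Proof.
rewrite /cis cosD sinD; apply/eqP; rewrite eq_complex /=.
by apply/andP; split; apply/eqP; ring.
Qed.

Lemma cis0 : cis 0 = 1.
Proof. by rewrite /cis cos0 sin0. Qed.

Lemma cisX t n : cis (t * n%:R) = cis t ^+ n.
Proof.
elim: n => [|n IH]; first by rewrite mulr0 cis0.
by rewrite -natr1 mulrDr mulr1 cisD IH exprSr.
Qed.

Lemma cis_2pi n : cis (2 * pi * n%:R) = 1.
Proof.
by rewrite cisX (mulrC 2) mulr_natr /cis cos2pi sin2pi expr1n.
Qed.

Lemma cis_2pi_int (z : int) : cis (2 * pi * z%:~R) = 1.
Proof.
case: z => n; first exact: cis_2pi.
rewrite NegzE mulrNz mulrN; apply: (@mulIf _ (cis (2 * pi * n.+1%:R))).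
  by rewrite cis_2pi oner_neq0.
by rewrite -cisD addNr cis0 cis_2pi mulr1.
Qed.

Lemma mvt_lip (f df : R -> R) :
  (forall x : R, is_derive x (1 : R) f (df x)) -> (forall x, `|df x| <= 1) ->
  forall s t, `|f s - f t| <= `|s - t|.
Proof.
move=> fdf df1 s t.
wlog st : s t / s < t.
  move=> H; case: (ltgtP s t) => [/H//|/H|->]; last by rewrite !subrr normr0.
  by rewrite distrC (distrC t).
have [|c _ fE] := @MVT R f df s t st (fun x _ => fdf x).
  apply: continuous_subspaceT => x; apply: differentiable_continuous.
  by apply/derivable1_diffP; case: (fdf x).
rewrite distrC (distrC s) fE normrM ler_piMl //.
Qed.

Lemma cos_lip s t : `|cos s - cos t| <= `|s - t| :> R.
Proof.
by apply: (mvt_lip (@is_derive_cos R)) => x; rewrite normrN sin_max.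
Qed.

Lemma sin_lip s t : `|sin s - sin t| <= `|s - t| :> R.
Proof. exact: (mvt_lip (@is_derive_sin R) (@cos_max R)). Qed.

(** Below 1 the derivative of [sin] is at least [cos 1], and beyond 1 the sine is
    at least [sin 1 >= cos 1] while [t <= pi / 2 < 2]. *)
Lemma sin_lower (t : R) : 0 <= t <= pi / 2 -> cos 1 / 2 * t <= sin t.
Proof.
move=> /andP[t0 t2].
have c1 : 0 < cos 1 :> R by exact: cos1_gt0.
have pi2 : 2 <= pi :> R by exact: pi_ge2.
have small x : 0 <= x <= 1 -> cos 1 * x <= sin x :> R.
  move=> /andP[]; rewrite le_eqVlt => /predU1P[<- _|x0 x1].
    by rewrite mulr0 sin0.
  have [|c] := @MVT R sin cos 0 x x0 (fun y _ => is_derive_sin y).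
    exact/continuous_subspaceT/continuous_sin.
  rewrite in_itv /= => /andP[c0 cx] sE.
  move: sE; rewrite sin0 !subr0 => ->; rewrite ler_pM2r //.
  rewrite leNgt ltr_cos ?in_itv /= -?leNgt; lra.
case: (leP t 1) => t1.
  by have := small t; rewrite t0 t1 => /(_ isT); nra.
have s1 : cos 1 <= sin 1 :> R by have := small 1; rewrite ler01 lexx mulr1 => /(_ isT).
have st : sin 1 <= sin t :> R.
  rewrite ltW // ltr_sin ?in_itv /=; lra.
have pi4 : t <= 2.
  by apply: le_trans t2 _; rewrite ltW // pihalf_lt2.
by nra.
Qed.

(** The [k]-th power of the standard primitive [n]-th root of unity. *)
Definition croot n k : R[i] := cis (2 * pi * k%:R / n%:R).

Lemma croot_exp n k j : croot n k ^+ j = cis (2 * pi * (k * j)%:R / n%:R).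
Proof. by rewrite -cisX natrM; congr cis; ring. Qed.

Lemma croot_expn n k : (0 < n)%N -> croot n k ^+ n = 1.
Proof.
move=> n0; rewrite croot_exp natrM mulrA mulfK ?cis_2pi //.
by rewrite pnatr_eq0 -lt0n.
Qed.

Lemma one_sub_cos (t : R) : 1 - cos t = 2 * sin (t / 2) ^+ 2.
Proof.
have {1}-> : t = (t / 2) *+ 2 by rewrite -mulr_natr divfK ?pnatr_eq0.
by rewrite cos_mulr2n cos2sin2; ring.
Qed.

(** The real part of [1 - cis t] is [2 * sin (t / 2) ^ 2], and half the angle of
    the root lies strictly between 0 and [pi]. *)
Lemma croot_neq1 n k : (0 < k < n)%N -> croot n k != 1.
Proof.
move=> /andP[k0 kn]; apply/eqP => /(congr1 (@complex.Re R)) /= cos1.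
have n0 : 0 < n%:R :> R by rewrite ltr0n (leq_ltn_trans _ kn).
have : 0 < sin (2 * pi * k%:R / n%:R / 2) :> R.
  have -> : 2 * pi * k%:R / n%:R / 2 = pi * (k%:R / n%:R) :> R by field; lra.
  apply: sin_gt0_pi; have := pi_gt0 R => pi0.
  have kn0 : 0 < k%:R / n%:R :> R by rewrite divr_gt0 // ltr0n.
  rewrite mulr_gt0 //= gtr_pMr //.
  by rewrite ltr_pdivrMr // mul1r ltr_nat.
move=> /(exprn_gt0 2); have := one_sub_cos (2 * pi * k%:R / n%:R).
by rewrite cos1; lra.
Qed.

Lemma sum_croot n k : (0 < k < n)%N -> \sum_(j < n) croot n k ^+ j = 0.
Proof.
move=> kn; have n0 : (0 < n)%N by case/andP: kn => _; exact: leq_ltn_trans.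
have := subrX1 (croot n k) n; rewrite croot_expn // subrr => /esym/eqP.
by rewrite mulf_eq0 subr_eq0 (negPf (croot_neq1 kn)) => /eqP.
Qed.

Lemma cexpE n k j :
  cexp ((2 * pi)%:C * 'i%C / n%:R * k%:R * j%:R) = croot n k ^+ j.
Proof.
have -> : (2 * pi)%:C * 'i%C / n%:R * k%:R * j%:R =
    0 +i* (2 * pi * (k * j)%:R / n%:R) :> R[i].
  have -> : (2 * pi)%:C * 'i%C / n%:R * k%:R * j%:R =
      (2 * pi * (k * j)%:R / n%:R)%:C * 'i%C :> R[i].
    by rewrite natrM !rmorphM /= fmorphV !rmorph_nat; ring.
  by apply/eqP; rewrite eq_complex /= !mulr0 !mul0r subrr mulr1 addr0 !eqxx.
by rewrite /cexp /= expR0 mul1r croot_exp.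
Qed.

End UnitCircle.

(** * Equidistribution on the circle *)

Section Equidistribution.
Set Implicit Arguments.
Unset Strict Implicit.

Variable R : realType.

Lemma Re_sum n (F : 'I_n -> R[i]) :
  complex.Re (\sum_(j < n) F j) = \sum_(j < n) complex.Re (F j).
Proof. by apply: (big_morph (@complex.Re R)) => // -[a b] [a' b']. Qed.

Lemma Im_sum n (F : 'I_n -> R[i]) :
  complex.Im (\sum_(j < n) F j) = \sum_(j < n) complex.Im (F j).
Proof. by apply: (big_morph (@complex.Im R)) => // -[a b] [a' b']. Qed.

Lemma Re_sub (z z' : R[i]) : complex.Re (z - z') = complex.Re z - complex.Re z'.
Proof. by case: z => a b; case: z'. Qed.

Lemma Im_sub (z z' : R[i]) : complex.Im (z - z') = complex.Im z - complex.Im z'.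
Proof. by case: z => a b; case: z'. Qed.

Lemma Re_scale (r : R) z : complex.Re (r%:C * z) = r * complex.Re z.
Proof. by case: z => a b; rewrite /= mul0r subr0. Qed.

Lemma Im_scale (r : R) z : complex.Im (r%:C * z) = r * complex.Im z.
Proof. by case: z => a b; rewrite /= mul0r addr0. Qed.

Lemma norm_le_ReIm (z : R[i]) (e : R) :
  `|complex.Re z| + `|complex.Im z| <= e -> `|z| <= e%:C.
Proof.
move=> ze; rewrite normc_def lecE /= eqxx /=.
apply: le_trans ze; rewrite -[leRHS]ger0_norm ?addr_ge0 // -sqrtr_sqr.
rewrite ler_wsqrtr // sqrrD !real_normK ?num_real //.
by rewrite lerD2r lerDl mulrn_wge0 // mulr_ge0.
Qed.

Lemma Re_le_norm (z : R[i]) (e : R) : `|z| <= e%:C -> `|complex.Re z| <= e.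
Proof.
rewrite normc_def lecE /= eqxx /=; apply: le_trans.
by rewrite -sqrtr_sqr ler_wsqrtr // lerDl sqr_ge0.
Qed.

Lemma Im_le_norm (z : R[i]) (e : R) : `|z| <= e%:C -> `|complex.Im z| <= e.
Proof.
rewrite normc_def lecE /= eqxx /=; apply: le_trans.
by rewrite -sqrtr_sqr ler_wsqrtr // lerDr sqr_ge0.
Qed.

(** A positive element of [R[i]] is real, so real bounds suffice. *)
Lemma eqo1_seqP (f : nat -> R[i]^o) :
  f =o_\oo (fun _ => 1 : R[i]^o) <->
  forall e : R, 0 < e -> \forall n \near \oo, `|f n| <= e%:C.
Proof.
split=> [/eqoP H e e_gt0|H].
  have e_gt0' : 0 < e%:C by rewrite ltcR.
  by apply: filterS (H _ e_gt0') => n; rewrite normr1 mulr1.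
apply/eqoP => e e_gt0.
have [eI e_gt0'] : complex.Im e = 0 /\ 0 < complex.Re e.
  by move: e_gt0; rewrite ltcE /= => /andP[/eqP -> ->].
apply: filterS (H _ e_gt0') => n; rewrite normr1 mulr1.
by case: e eI {e_gt0 e_gt0'} => a b /= ->.
Qed.

Lemma eqaddo1_seqP (f g : nat -> R[i]^o) :
  f = g +o_\oo (fun _ => 1 : R[i]^o) <->
  forall e : R, 0 < e -> \forall n \near \oo, `|f n - g n| <= e%:C.
Proof.
rewrite -(eqo1_seqP (f - g)); split=> [/eqaddoP H|/eqoP H]; first exact/eqoP.
exact/eqaddoP.
Qed.

Lemma circle_rep_to (x : R) : circle_rep (to_circle x) - x \is a Num.int.
Proof.
rewrite /circle_rep /to_circle.
have : eqmodZ_equiv R (repr (\pi_({eq_quot eqmodZ_equiv R})%qT x)) x.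
  by apply/eqmodP; rewrite reprK.
rewrite /= /eqmodZ => H.
by rewrite addrAC rpredB ?intr_int.
Qed.

Lemma circle_rep01 (p : circle R) : 0 <= circle_rep p < 1.
Proof.
rewrite /circle_rep /=.
move: (repr _) => x.
by rewrite subr_ge0 floor_le_tmp ltrBlDr addrC -[1]/(1%:~R) -intrD floorD1_gt.
Qed.

(** The difference of the representatives differs from [x - y] by an integer; if
    this integer is not 0, the second term of the minimum is the bound. *)
Lemma circle_dist_to (x y : R) :
  circle_dist (to_circle x) (to_circle y) <= `|x - y|.
Proof.
rewrite /circle_dist.
have := circle_rep_to x; have := circle_rep_to y.
move: (circle_rep (to_circle x)) (circle_rep (to_circle y)) => a b.
move=> /intrP[m bm] /intrP[k ak].
have -> : x - y = (a - b) - (k - m)%:~R.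
  by rewrite rmorphB /= -ak -bm; ring.
have [->|km] := eqVneq (k - m) 0; first by rewrite subr0 ge_min lexx.
rewrite ge_min; apply/orP; right.
have : 1 <= `|(k - m)%:~R : R|.
  by rewrite -intr_norm -[1]/(1%:~R) ler_int -gtz0_ge1 normr_gt0.
have := ler_normD ((a - b) - (k - m)%:~R) (- (a - b)).
rewrite addrAC subrr sub0r !normrN; lra.
Qed.

Lemma circle_dist_ge0 (p q : circle R) : 0 <= circle_dist p q.
Proof.
rewrite /circle_dist; have := circle_rep01 p; have := circle_rep01 q.
move=> /andP[q0 q1] /andP[p0 p1]; rewrite le_min normr_ge0 subr_ge0 /=.
by rewrite ler_norml; lra.
Qed.

Lemma circle_lipschitz_lift (f : circle R -> R[i]) : circle_lipschitz f ->
  exists K : R, [/\ 0 <= K,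
    lip_on_line K (fun x => complex.Re (f (to_circle x)))
    & lip_on_line K (fun x => complex.Im (f (to_circle x)))].
Proof.
move=> [K fK]; exists `|K|.
have fxy x y : `|f (to_circle x) - f (to_circle y)| <= (`|K| * `|x - y|)%:C.
  apply: le_trans (fK _ _) _; rewrite lecR.
  apply: le_trans (ler_wpM2r (circle_dist_ge0 _ _) (ler_norm K)) _.
  by rewrite ler_wpM2l // circle_dist_to.
split=> // x y.
  by have := Re_le_norm (fxy x y); rewrite Re_sub.
by have := Im_le_norm (fxy x y); rewrite Im_sub.
Qed.

Lemma Re_average n (F : 'I_n -> R[i]) (c : 'I_n -> bool) :
  complex.Re (n%:R^-1 * \sum_(j < n) (c j)%:R * F j) =
  n%:R^-1 * \sum_(j < n) (c j)%:R * complex.Re (F j).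
Proof.
rewrite -(rmorph_nat (real_complex R)) -fmorphV Re_scale Re_sum; congr (_ * _).
by apply: eq_bigr => j _; rewrite -(rmorph_nat (real_complex R)) Re_scale.
Qed.

Lemma Im_average n (F : 'I_n -> R[i]) (c : 'I_n -> bool) :
  complex.Im (n%:R^-1 * \sum_(j < n) (c j)%:R * F j) =
  n%:R^-1 * \sum_(j < n) (c j)%:R * complex.Im (F j).
Proof.
rewrite -(rmorph_nat (real_complex R)) -fmorphV Im_scale Im_sum; congr (_ * _).
by apply: eq_bigr => j _; rewrite -(rmorph_nat (real_complex R)) Im_scale.
Qed.

Lemma balanced_equidistributed (d : R) (w : forall n, n.-tuple bool) :
  0 <= d <= 1 -> balanced d w ->
  forall f : circle R -> R[i], circle_lipschitz f ->
    (fun n => n%:R^-1 * \sum_(j < n) (tnth (w n) j)%:R *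
                f (to_circle ((j.+1)%:R / n%:R)) : R[i]^o)
    = (fun _ => d%:C * circle_integral f : R[i]^o) +o_\oo (fun _ => 1 : R[i]^o).
Proof.
move=> d01 wb f /circle_lipschitz_lift[K [K0 reK imK]].
apply/eqaddo1_seqP => e e_gt0.
have e2_gt0 : 0 < e / 2 by rewrite divr_gt0.
have re := balanced_weighted_average d01 wb reK K0 e2_gt0.
have im := balanced_weighted_average d01 wb imK K0 e2_gt0.
apply: filterS2 re im => n re im.
apply: norm_le_ReIm; rewrite (splitr e); apply: lerD.
  by rewrite Re_sub Re_scale Re_average.
by rewrite Im_sub Im_scale Im_average.
Qed.

Definition circle_char (k : nat) (p : circle R) : R[i] :=
  cis (2 * pi * k%:R * circle_rep p).

Lemma cis_lip (s t : R) : `|cis s - cis t| <= (2 * `|s - t|)%:C.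
Proof.
apply: norm_le_ReIm => /=; rewrite mulr_natl mulr2n lerD //.
  exact: cos_lip.
exact: sin_lip.
Qed.

Lemma circle_char_to k (x : R) :
  circle_char k (to_circle x) = cis (2 * pi * k%:R * x).
Proof.
rewrite /circle_char; have /intrP[m xm] := circle_rep_to x.
have -> : circle_rep (to_circle x) = x + m%:~R by rewrite -xm addrC subrK.
rewrite mulrDr cisD -[in X in _ * X]mulrA -[k%:R]/(k%:~R) -intrM cis_2pi_int.
by rewrite mulr1.
Qed.

(** When the shorter arc passes through 0, one representative is moved by 1,
    which does not change the character. *)
Lemma circle_char_lip k : circle_lipschitz (circle_char k).
Proof.
exists (2 * (2 * pi * k%:R)) => p q; rewrite /circle_char /circle_dist.
have := circle_rep01 p; have := circle_rep01 q.
move: (circle_rep p) (circle_rep q) => a b b01 a01.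
have c0 : 0 <= 2 * pi * k%:R :> R by rewrite !mulr_ge0 // pi_ge0.
set c := 2 * pi * k%:R in c0 *.
have lip s t : `|cis (c * s) - cis (c * t)| <= (2 * c * `|s - t|)%:C.
  apply: le_trans (cis_lip _ _) _.
  by rewrite lecR -mulrBr normrM (ger0_norm c0) mulrA.
have per s : cis (c * (s + 1)) = cis (c * s).
  by rewrite mulrDr cisD mulr1 cis_2pi mulr1.
case: (leP `|a - b| (1 - `|a - b|)) => _; first exact: lip.
case: (leP b a) => ba.
  rewrite -(per b); apply: le_trans (lip _ _) _.
  rewrite lecR ler_wpM2l ?(mulr_ge0 _ c0) //.
  rewrite (ger0_norm (_ : 0 <= a - b)) ?subr_ge0 // ler_norml; lra.
rewrite -(per a); apply: le_trans (lip _ _) _.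
rewrite lecR ler_wpM2l ?(mulr_ge0 _ c0) //.
rewrite (ltr0_norm (_ : a - b < 0)) ?subr_lt0 // ler_norml; lra.
Qed.

Lemma circle_char_root n k (j : nat) :
  circle_char k (to_circle (j%:R / n%:R)) = croot R n k ^+ j.
Proof.
by rewrite circle_char_to croot_exp natrM; congr cis; ring.
Qed.

Lemma small_eq0 (a K : R) (N : nat) : 0 <= K ->
  (forall n, (N < n)%N -> `|0 - a| <= K / n%:R) -> a = 0.
Proof.
move=> K0 aK; apply/eqP; rewrite -normr_le0 leNgt; apply/negP => a_gt0.
have := @nbhs_infty_ger R ((K + 1) / `|a|) => big.
have : \forall n \near \oo, (K + 1) / `|a| <= n%:R /\ (N < n)%N.
  by apply: filterS2 big (nbhs_infty_gt N) => n.
case=> n0 _ /(_ n0 (leqnn n0)) /= [big0 Nn].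
have := aK n0 Nn; rewrite sub0r normrN ler_pdivlMr; last first.
  by rewrite ltr0n (leq_ltn_trans _ Nn).
move: big0; rewrite ler_pdivrMr // mulrC; lra.
Qed.

(** The integral is the limit of Riemann sums, and these are sums of powers of a
    nontrivial root of unity, hence 0, as soon as [n > k]. *)
Lemma circle_char_integral k : (0 < k)%N -> circle_integral (circle_char k) = 0.
Proof.
move=> k0; have [K [K0 reK imK]] := circle_lipschitz_lift (circle_char_lip k).
have sum0 n : (k < n)%N ->
    \sum_(j < n) circle_char k (to_circle (j.+1%:R / n%:R)) = 0 :> R[i].
  move=> kn; under eq_bigr => j _ do rewrite circle_char_root exprS.
  by rewrite -mulr_sumr sum_croot ?k0 // mulr0.
rewrite /circle_integral.
rewrite (@small_eq0 (Rintegral _ _ (fun x => complex.Re _)) K k K0); last first.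
  move=> n kn; have n0 : (0 < n)%N by exact: leq_ltn_trans kn.
  by have := riemann_sum_lip reK K0 n0; rewrite -Re_sum sum0 // mulr0.
rewrite (@small_eq0 (Rintegral _ _ (fun x => complex.Im _)) K k K0) // => n kn.
have n0 : (0 < n)%N by exact: leq_ltn_trans kn.
by have := riemann_sum_lip imK K0 n0; rewrite -Im_sum sum0 // mulr0.
Qed.

Lemma equidistributed_expsum (d : R) (w : forall n, n.-tuple bool) :
  (forall f : circle R -> R[i], circle_lipschitz f ->
    (fun n => n%:R^-1 * \sum_(j < n) (tnth (w n) j)%:R *
                f (to_circle ((j.+1)%:R / n%:R)) : R[i]^o)
    = (fun _ => d%:C * circle_integral f : R[i]^o) +o_\oo (fun _ => 1 : R[i]^o)) ->
  forall k : nat, k <> 0%N ->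
    (fun n => n%:R^-1 * \sum_(j < n) (tnth (w n) j)%:R *
                cexp ((2 * pi)%:C * 'i%C / n%:R * k%:R * (j.+1)%:R) : R[i]^o)
    =o_\oo (fun _ => 1 : R[i]^o).
Proof.
move=> weq k /eqP; rewrite -lt0n => k0; apply/eqo1_seqP => e e_gt0.
have /eqaddo1_seqP/(_ e e_gt0) := weq _ (circle_char_lip k).
apply: filterS => n; rewrite circle_char_integral // mulr0 subr0.
by under eq_bigr => j _ do rewrite circle_char_root -cexpE.
Qed.

End Equidistribution.

(** * Fourier analysis on the cyclic group *)

Section FourierOnCyclicGroup.
Set Implicit Arguments.
Unset Strict Implicit.

Variable R : realType.

(** The square of the modulus, as an element of [R] rather than of [R[i]]. *)
Definition sqmod (z : R[i]) : R := complex.Re z ^+ 2 + complex.Im z ^+ 2.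

Lemma sqmodM z z' : sqmod (z * z') = sqmod z * sqmod z'.
Proof. by case: z => a b; case: z' => a' b'; rewrite /sqmod /=; ring. Qed.

Lemma sqmod_cis t : sqmod (cis t) = 1.
Proof. exact: cos2Dsin2. Qed.

Lemma sqmod_ge0 z : 0 <= sqmod z.
Proof. by rewrite addr_ge0 ?sqr_ge0. Qed.

Lemma sqmod_le (z : R[i]) (e : R) : `|z| <= e%:C -> sqmod z <= e ^+ 2.
Proof.
rewrite normc_def lecE /= eqxx /= -/(sqmod z) => ze.
rewrite -(sqr_sqrtr (sqmod_ge0 z)) lerXn2r ?nnegrE ?sqrtr_ge0 //.
by apply: le_trans ze; rewrite sqrtr_ge0.
Qed.

Lemma sqmod_1_cis (t : R) : sqmod (1 - cis t) = 4 * sin (t / 2) ^+ 2.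
Proof.
have -> : sqmod (1 - cis t) = 2 * (1 - cos t).
  by have := cos2Dsin2 t; rewrite /sqmod /=; lra.
by rewrite one_sub_cos; ring.
Qed.

Definition dft (n : nat) (a : nat -> R) (k : nat) : R[i] :=
  \sum_(j < n) (a j)%:C * croot R n k ^+ j.

Definition angle (n k j : nat) : R := 2 * pi * (k * j)%:R / n%:R.

Lemma sum_cos_angle n (i j : 'I_n) :
  \sum_(k < n) cos (angle n k i - angle n k j) = n%:R * (i == j)%:R :> R.
Proof.
have off (a b : 'I_n) : (b < a)%N ->
    \sum_(k < n) cos (angle n k a - angle n k b) = 0 :> R.
  move=> ba; have ab : (0 < a - b < n)%N.
    by rewrite subn_gt0 ba /= (leq_ltn_trans (leq_subr _ _)).
  have := congr1 (@complex.Re R) (sum_croot R ab); rewrite Re_sum /= => H.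
  rewrite -[RHS]H; apply: eq_bigr => k _; rewrite croot_exp /=; congr cos.
  by rewrite /angle -mulrBl -mulrBr -natrB ?leq_mul2l ?(ltnW ba) ?orbT // -mulnBr mulnC.
case: (ltngtP i j) => [ij|ji|/val_inj ->].
- rewrite (_ : (i == j) = false) ?mulr0; last by rewrite -val_eqE ltn_eqF.
  by rewrite -[RHS](off j i ij); apply: eq_bigr => k _; rewrite -cosN opprB.
- by rewrite (_ : (i == j) = false) ?mulr0 ?off //; rewrite -val_eqE gtn_eqF.
- rewrite eqxx mulr1; under eq_bigr => k _ do rewrite subrr cos0.
  by rewrite sumr_const card_ord.
Qed.

Lemma sqmod_dft n a k :
  sqmod (dft n a k) =
  \sum_(i < n) \sum_(j < n) a i * a j * cos (angle n k i - angle n k j).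
Proof.
rewrite /sqmod /dft Re_sum Im_sum.
under eq_bigr => j _ do rewrite Re_scale croot_exp.
under [X in _ + X ^+ 2]eq_bigr => j _ do rewrite Im_scale croot_exp.
rewrite /= -!/(angle _ _ _) !expr2 !mulr_suml -big_split /=.
apply: eq_bigr => i _; rewrite !mulr_sumr -big_split /=.
by apply: eq_bigr => j _; rewrite cosB; ring.
Qed.

Lemma parseval n a :
  \sum_(k < n) sqmod (dft n a k) = n%:R * \sum_(j < n) a j ^+ 2.
Proof.
under eq_bigr => k _ do rewrite sqmod_dft.
rewrite exchange_big mulr_sumr; apply: eq_bigr => i _ /=.
rewrite exchange_big /=.
under eq_bigr => j _ do rewrite -mulr_sumr sum_cos_angle.
rewrite (bigD1 i) //= [X in _ + X]big1 => [|j ij].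
  by rewrite eqxx mulr1; ring.
by rewrite eq_sym (negPf ij) !mulr0.
Qed.

Lemma sqmod_dft_opp n a k : (0 < n)%N -> (k <= n)%N ->
  sqmod (dft n a (n - k)) = sqmod (dft n a k).
Proof.
move=> n0 kn; rewrite !sqmod_dft.
have refl j : cis (angle n (n - k) j) = cis (- angle n k j).
  have -> : angle n (n - k) j = 2 * pi * j%:R + - angle n k j.
    rewrite /angle !natrM natrB //; field.
    by rewrite pnatr_eq0 -lt0n.
  by rewrite cisD cis_2pi mul1r.
apply: eq_bigr => i _; apply: eq_bigr => j _; congr (_ * _).
have := congr1 (@complex.Re R) (refl i); have := congr1 (@complex.Im R) (refl i).
have := congr1 (@complex.Re R) (refl j); have := congr1 (@complex.Im R) (refl j).
by rewrite /= !cosB !cosN !sinN => -> -> -> ->; ring.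
Qed.

(** Differences multiply the Fourier coefficient at [k] by a number of modulus
    [|1 - croot n k|]; the cyclic shift is legitimate since [T n = T 0]. *)
Lemma dft_diff n (T x : nat -> R) k : (0 < n)%N -> T n = T 0 ->
  (forall j, (j < n)%N -> T j.+1 - T j = x j) ->
  sqmod (dft n T k) * (4 * sin (pi * k%:R / n%:R) ^+ 2) = sqmod (dft n x k).
Proof.
move=> n0 Tn Tx.
have cyc : \sum_(j < n) (T j.+1)%:C * croot R n k ^+ j.+1 = dft n T k.
  pose F j := (T j)%:C * croot R n k ^+ j.
  apply: (@addrI _ (F 0%N)); rewrite -[LHS](big_ord_recl n (fun j : 'I_n.+1 => F j)).
  by rewrite big_ord_recr /= {2}/F croot_expn // Tn addrC.
have rel : dft n T k * (1 - croot R n k) = croot R n k * dft n x k.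
  rewrite mulrBr mulr1 -[X in X - _]cyc mulrC.
  rewrite /dft mulr_sumr mulr_sumr -sumrB.
  apply: eq_bigr => j _; rewrite -Tx // rmorphB /= exprS; ring.
transitivity (sqmod (croot R n k * dft n x k)); last by rewrite sqmodM sqmod_cis mul1r.
rewrite -rel sqmodM sqmod_1_cis; congr (_ * (_ * sin _ ^+ 2)).
by field; rewrite pnatr_eq0 -lt0n.
Qed.

(** The symmetry [k -> n - k] reduces to angles at most [pi / 2], where
    [sin_lower] applies; [pi >= 2] absorbs its factor [1 / 2]. *)
Lemma sin_lower_min n k m : (0 < k < n)%N -> (m <= minn k (n - k))%N ->
  cos 1 * m%:R / n%:R <= sin (pi * k%:R / n%:R) :> R.
Proof.
move=> /andP[k0 kn] mk.
have n0 : 0 < n%:R :> R by rewrite ltr0n (leq_ltn_trans _ kn).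
have c1 : 0 < cos 1 :> R by exact: cos1_gt0.
have pi2 : 2 <= pi :> R by exact: pi_ge2.
wlog k2 : k k0 kn mk / (2 * k <= n)%N.
  move=> H; case: (leqP (2 * k) n) => [/(H k k0 kn mk) //|k2].
  have -> : sin (pi * k%:R / n%:R) = sin (pi * (n - k)%:R / n%:R) :> R.
    have -> : pi * (n - k)%:R / n%:R = - (pi * k%:R / n%:R) + pi :> R.
      by rewrite natrB ?(ltnW kn) //; field; lra.
    by rewrite sinDpi sinN opprK.
  apply: H; first by rewrite subn_gt0.
  - by rewrite ltn_subrL k0 (leq_ltn_trans _ kn).
  - by rewrite subKn ?(ltnW kn) // minnC.
  - lia.
have mk' : m%:R <= k%:R :> R by rewrite ler_nat (leq_trans mk) ?geq_minl.
have kR : k%:R / n%:R <= 1 / 2 :> R.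
  have : (2 * k)%:R <= n%:R :> R by rewrite ler_nat.
  by rewrite ler_pdivrMr // natrM; lra.
have k0R : 0 <= k%:R / n%:R :> R by rewrite divr_ge0.
apply: le_trans (sin_lower _).
  rewrite -!mulrA; have : m%:R / n%:R <= k%:R / n%:R :> R.
    by rewrite ler_pM2r ?invr_gt0.
  move: (m%:R / n%:R) (k%:R / n%:R) k0R => a b b0 ab.
  by rewrite ler_pM2l //; nra.
by rewrite -mulrA mulr_ge0 //=; [nra|lra].
Qed.

(** At a frequency [k] with [min k (n - k) <= K], the coefficient of [T] is at most
    [n / cos 1] times that of [x], which is at most [D] in square; there are at
    most [2 * K] such [k] besides 0. At the others one gains a factor [K], and
    the coefficients of [x] sum to at most [n ^ 2] in square by Parseval. *)
Lemma mean_square_from_low_frequencies n K (D : R) (T x : nat -> R) :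
  (0 < n)%N -> (0 < K)%N -> 0 <= D ->
  T n = T 0 -> (forall j, (j < n)%N -> T j.+1 - T j = x j) ->
  (forall j, (j < n)%N -> `|x j| <= 1) ->
  \sum_(j < n) T j = 0 ->
  (forall k, (0 < k < n)%N -> (k <= K)%N -> sqmod (dft n x k) <= D) ->
  \sum_(j < n) T j ^+ 2
  <= n%:R / cos 1 ^+ 2 * ((2 * K).+1%:R * D + n%:R ^+ 2 / K%:R ^+ 2).
Proof.
move=> n0 K0 D0 Tn Tx x1 T0 xD.
have n0' : 0 < n%:R :> R by rewrite ltr0n.
have K0' : 0 < K%:R :> R by rewrite ltr0n.
have c1 : 0 < cos 1 :> R by exact: cos1_gt0.
(* The boolean sum counts in how many ways [k] is a low frequency. *)
have term (k : 'I_n) : sqmod (dft n T k) <= (n%:R / cos 1) ^+ 2 *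
    (((k <= K) + (n - k <= K))%:R * D + sqmod (dft n x k) / K%:R ^+ 2).
  have [k0|k0] := posnP k.
    have -> : sqmod (dft n T k) = 0.
      rewrite /dft; under eq_bigr => j _ do
        rewrite croot_exp k0 mul0n mulr0 mul0r cis0 mulr1.
      by rewrite -rmorph_sum /= T0 /sqmod /= expr0n addr0.
    by rewrite mulr_ge0 ?sqr_ge0 // addr_ge0 ?mulr_ge0 ?invr_ge0 ?sqr_ge0 ?sqmod_ge0.
  have kn : (0 < k < n)%N by rewrite k0 /=.
  have bound m : (0 < m)%N -> (m <= minn k (n - k))%N ->
      sqmod (dft n T k) <= (n%:R / cos 1) ^+ 2 * (sqmod (dft n x k) / m%:R ^+ 2).
    move=> m0 mk; have sm := sin_lower_min kn mk.
    have m0' : 0 < m%:R :> R by rewrite ltr0n.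
    have q0 : 0 < cos 1 * m%:R / n%:R :> R by rewrite divr_gt0 ?mulr_gt0.
    rewrite -(dft_diff k n0 Tn Tx) (mulrC (sqmod _)) mulrA mulrA mulrAC.
    rewrite ler_peMl ?sqmod_ge0 //.
    have : (cos 1 * m%:R / n%:R) ^+ 2 <= sin (pi * k%:R / n%:R) ^+ 2 :> R.
      by rewrite lerXn2r ?nnegrE ?(ltW q0) // (le_trans (ltW q0)).
    have -> : n%:R / cos 1 = m%:R / (cos 1 * m%:R / n%:R) :> R.
      by field; lra.
    move: (cos 1 * _ / _) (sin _ ^+ 2) q0 => q s q0 qs.
    have -> : (m%:R / q) ^+ 2 * (4 * s) / m%:R ^+ 2 = 4 * s / q ^+ 2.
      by field; lra.
    rewrite ler_pdivlMr ?exprn_gt0 //; nra.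
  set low := ((k <= K) + (n - k <= K))%N.
  have [low0|low_gt0] := posnP low.
    rewrite low0 mul0r add0r; apply: bound => //.
    by move: low0; rewrite /low; lia.
  apply: le_trans (bound 1%N isT _) _; first by rewrite leq_min k0 subn_gt0 ltn_ord.
  rewrite ler_wpM2l ?sqr_ge0 // expr1n divr1.
  have kD : sqmod (dft n x k) <= D.
    move: low_gt0; rewrite addn_gt0 !lt0b => /orP[|] kK; first exact: xD.
    have kn' := ltn_ord k; rewrite -(sqmod_dft_opp _ n0 (ltnW kn')).
    by apply: xD => //; lia.
  apply: le_trans kD _; rewrite -[leLHS]addr0 lerD //.
    by rewrite ler_peMl // ler1n.
  by rewrite divr_ge0 ?sqmod_ge0 ?sqr_ge0.
have count_low : (\sum_(k < n) ((k <= K) + (n - k <= K)) <= (2 * K).+1)%N.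
  have cnt M : (\sum_(k < n) (k < M) = minn n M)%N.
    elim: (n) => [|n' IH]; first by rewrite big_ord0 min0n.
    by rewrite big_ord_recr /= IH; case: (ltnP n' M) => /=; lia.
  rewrite big_split /= (cnt K.+1) [X in (_ + X)%N](reindex_inj rev_ord_inj) /=.
  rewrite (eq_bigr (fun k : 'I_n => (k < K)%N : nat)) ?cnt => [|k _]; first by lia.
  by rewrite subKn.
rewrite -(ler_pM2l n0') -parseval.
apply: le_trans (ler_sum _ (fun k _ => term k)) _.
rewrite -mulr_sumr big_split /= -!mulr_suml parseval -natr_sum.
have -> : n%:R * (n%:R / cos 1 ^+ 2 * ((2 * K).+1%:R * D + n%:R ^+ 2 / K%:R ^+ 2)) =
    (n%:R / cos 1) ^+ 2 * ((2 * K).+1%:R * D + n%:R ^+ 2 / K%:R ^+ 2) :> R.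
  by field; lra.
rewrite ler_wpM2l ?sqr_ge0 // lerD //; first by rewrite ler_wpM2r // ler_nat.
rewrite ler_pM2r ?invr_gt0 ?exprn_gt0 // expr2 ler_pM2l //.
rewrite -[X in _ <= X%:R]card_ord -sumr_const; apply: ler_sum => j _.
by rewrite -real_normK ?num_real // expr_le1 // x1.
Qed.

End FourierOnCyclicGroup.

(** * From exponential sums to small discrepancy *)

Section ExponentialSums.
Set Implicit Arguments.
Unset Strict Implicit.

Variables (R : realType) (d : R) (w : forall n, n.-tuple bool).

Lemma ones_nth n (v : n.-tuple bool) :
  (ones v)%:R = \sum_(j < n) (nth false v j)%:R :> R.
Proof.
rewrite /ones natr_sum; apply: eq_bigr => j _.
by rewrite (tnth_nth false).
Qed.

(** A constant has no Fourier coefficient at [k <> 0], and shifting the index by 1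
    multiplies the coefficient by a number of modulus 1. *)
Lemma dft_centered n (v : n.-tuple bool) (c : R) k : (0 < k < n)%N ->
  sqmod (dft n (fun j => (nth false v j)%:R - c) k) =
  sqmod (\sum_(j < n) (tnth v j)%:R * croot R n k ^+ j.+1).
Proof.
move=> kn.
have -> : \sum_(j < n) (tnth v j)%:R * croot R n k ^+ j.+1 =
    croot R n k * dft n (fun j => (nth false v j)%:R - c) k.
  have -> : dft n (fun j => (nth false v j)%:R - c) k =
      \sum_(j < n) (tnth v j)%:R * croot R n k ^+ j.
    have c0 : \sum_(j < n) c%:C * croot R n k ^+ j = 0.
      by rewrite -mulr_sumr sum_croot // mulr0.
    rewrite -[RHS]subr0 -[X in _ = _ - X]c0 -sumrB; apply: eq_bigr => j _.
    by rewrite rmorphB rmorph_nat mulrBl (tnth_nth false).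
  by rewrite mulr_sumr; apply: eq_bigr => j _; rewrite exprS mulrCA.
by rewrite sqmodM sqmod_cis mul1r.
Qed.

(** With the empirical density [c] in place of [d] the partial sums [S] vanish at
    [n], which makes them periodic; the change of density costs the subtracted
    term. Only [S - mu], with [mu] the mean of [S], is controlled in mean
    square, but [S m] is the difference of its values at [m] and at 0. *)
Lemma prefix_disc_from_expsums n K (e r : R) (v : n.-tuple bool) :
  (0 < n)%N -> (0 < K)%N -> 0 <= e ->
  (forall k, (0 < k <= K)%N ->
    `|n%:R^-1 * \sum_(j < n) (tnth v j)%:R *
        cexp ((2 * pi)%:C * 'i%C / n%:R * k%:R * (j.+1)%:R)| <= e%:C) ->
  0 <= r ->
  8 * (n%:R ^+ 3 / cos 1 ^+ 2 * ((2 * K).+1%:R * e ^+ 2 + K%:R ^- 2))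
    + 4 * n%:R <= r ^+ 3 ->
  forall m, (m <= n)%N ->
    `|prefix_disc d v m - m%:R / n%:R * ((ones v)%:R - d * n%:R)| <= r + r.
Proof.
move=> n0 K0 e0 exps r0; set A := n%:R ^+ 3 / _ * _ => Ar m mn.
have n0' : 0 < n%:R :> R by rewrite ltr0n.
pose c : R := (ones v)%:R / n%:R.
pose x j : R := (nth false v j)%:R - c.
pose S j : R := \sum_(i < j) x i.
pose mu : R := n%:R^-1 * \sum_(j < n) S j.
pose T j : R := S j - mu.
have c01 : 0 <= c <= 1.
  rewrite /c divr_ge0 //= ler_pdivrMr // mul1r ler_nat /ones.
  apply: (@leq_trans (\sum_(i < n) 1)); first by apply: leq_sum => i _; exact: leq_b1.
  by rewrite sum_nat_const card_ord muln1.
have x1 j : `|x j| <= 1.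
  by rewrite /x ler_norml; case: (nth _ _ _) => /=; lra.
have Sn : S n = 0.
  rewrite /S sumrB -ones_nth sumr_const card_ord -[X in _ - X]mulr_natr /c.
  rewrite divfK ?subrr //.
  by rewrite gt_eqF.
have Tx j : T j.+1 - T j = x j.
  by rewrite /T /S big_ord_recr /=; ring.
have S_le j : (j <= n)%N -> `|S j| <= n%:R.
  move=> jn; apply: (@le_trans _ _ j%:R); last by rewrite ler_nat.
  rewrite -[X in X%:R]card_ord -sumr_const.
  by apply: le_trans (ler_norm_sum _ _ _) _; apply: ler_sum => i _; exact: x1.
have mu_le : `|mu| <= n%:R.
  rewrite normrM normfV normr_nat ler_pdivrMl //.
  apply: le_trans (ler_norm_sum _ _ _) _.
  rewrite mulr_natl -[X in _ *+ X]card_ord -sumr_const.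
  by apply: ler_sum => j _; rewrite S_le // ltnW.
have T_le j : (j <= n)%N -> `|T j| <= 2 * n%:R.
  move=> jn; apply: le_trans (ler_normB _ _) _.
  by rewrite mulr_natl mulr2n lerD // S_le.
have sumT : \sum_(j < n) T j = 0.
  rewrite sumrB sumr_const card_ord -[X in _ - X]mulr_natr /mu mulrAC.
  rewrite mulVf ?mul1r ?subrr //.
  by rewrite gt_eqF.
have low k : (0 < k < n)%N -> (k <= K)%N -> sqmod (dft n x k) <= (e * n%:R) ^+ 2.
  move=> kn kK; rewrite dft_centered //; apply: sqmod_le.
  have /exps : (0 < k <= K)%N by rewrite kK; case/andP: kn => ->.
  under eq_bigr => j _ do rewrite cexpE.
  rewrite normrM normfV normr_nat.
  rewrite ler_pdivrMl ?ltr0n // => /le_trans; apply.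
  by rewrite rmorphM /= rmorph_nat mulrC.
have sqT : \sum_(j < n) T j ^+ 2 <= A.
  apply: le_trans (@mean_square_from_low_frequencies R n K ((e * n%:R) ^+ 2) T x
    n0 K0 _ _ (fun j _ => Tx j) (fun j _ => x1 j) sumT low) _.
  - exact: sqr_ge0.
  - by rewrite /T Sn /S big_ord0.
  rewrite /A le_eqVlt; apply/orP; left; apply/eqP; field.
  have := cos1_gt0 R; have : 0 < K%:R :> R by rewrite ltr0n.
  by lra.
have T1 k : (k < n)%N -> `|T k.+1 - T k| <= 1 by rewrite Tx.
have T_r j : (j <= n)%N -> `|T j| <= r.
  move=> jn; rewrite -(@ler_pXn2r _ 3) ?nnegrE //.
  exact: le_trans (sup_from_mean_square n0 T1 T_le sqT jn) Ar.
have -> : prefix_disc d v m - m%:R / n%:R * ((ones v)%:R - d * n%:R) = T m - T 0%N.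
  have -> : T m - T 0%N = S m by rewrite /T /S big_ord0; ring.
  rewrite /prefix_disc /S /x !sumrB !sumr_const card_ord.
  rewrite -(mulr_natl d) -(mulr_natl c) /c.
  by field; rewrite gt_eqF.
by apply: le_trans (ler_normB _ _) _; rewrite lerD // T_r.
Qed.

Lemma expsum_balanced :
  (fun n => (ones (w n))%:R : R) = (fun n => d * n%:R) +o_\oo (fun n => n%:R : R) ->
  (forall k : nat, k <> 0%N ->
    (fun n => n%:R^-1 * \sum_(j < n) (tnth (w n) j)%:R *
                cexp ((2 * pi)%:C * 'i%C / n%:R * k%:R * (j.+1)%:R) : R[i]^o)
    =o_\oo (fun _ => 1 : R[i]^o)) ->
  balanced d w.
Proof.
move=> /eqaddo_seqP wd wexp e e_gt0.
have c1 : 0 < cos 1 :> R by exact: cos1_gt0.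
(* [e / 2] is kept for the change of density; the rest is two values of the
   centred partial sums, each at most [e / 4 * n]. *)
pose eta : R := (e / 4) ^+ 3 / 16.
have eta_gt0 : 0 < eta by rewrite divr_gt0 // exprn_gt0 // divr_gt0.
pose h : R := eta * cos 1 ^+ 2 / 2.
have h_gt0 : 0 < h by rewrite divr_gt0 // mulr_gt0 // exprn_gt0.
have [K K0 Kh] : exists2 K, (0 < K)%N & K%:R ^- 2 <= h.
  have hK := @nbhs_infty_ger R h^-1.
  have : \forall n \near \oo, h^-1 <= n%:R /\ (0 < n)%N.
    by apply: filterS2 hK (nbhs_infty_gt 0%N) => n.
  case=> K _ /(_ K (leqnn K)) /= [hK' K0]; exists K => //.
  have K1 : 1 <= K%:R :> R by rewrite ler1n.
  rewrite -[h]invrK lef_pV2 ?posrE ?exprn_gt0 ?invr_gt0 //; last by lra.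
  by apply: le_trans hK' _; rewrite expr2 ler_peMl //; lra.
pose delta : R := Num.min 1 (h / (2 * K).+1%:R).
have delta_gt0 : 0 < delta by rewrite lt_min ltr01 divr_gt0.
have delta_h : (2 * K).+1%:R * delta ^+ 2 <= h.
  have delta1 : delta <= 1 by rewrite ge_min lexx.
  apply: (@le_trans _ _ ((2 * K).+1%:R * delta)).
    by rewrite ler_wpM2l // expr2 ler_piMl // ltW.
  by rewrite mulrC -ler_pdivlMr // ge_min lexx orbT.
have exps : \forall n \near \oo, forall k, (0 < k <= K)%N ->
    `|n%:R^-1 * \sum_(j < n) (tnth (w n) j)%:R *
        cexp ((2 * pi)%:C * 'i%C / n%:R * k%:R * (j.+1)%:R)| <= delta%:C.
  have : \forall n \near \oo, forall k : 'I_K,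
      `|n%:R^-1 * \sum_(j < n) (tnth (w n) j)%:R *
          cexp ((2 * pi)%:C * 'i%C / n%:R * k.+1%:R * (j.+1)%:R)| <= delta%:C.
    apply: filter_forall => k.
    by have /eqo1_seqP := wexp k.+1 (@PeanoNat.Nat.neq_succ_0 k); exact.
  apply: filterS => n H [//|k] /= kK; exact: (H (Ordinal kK)).
near=> n; move=> m mn.
have n0 : (0 < n)%N by near: n; exact: nbhs_infty_gt.
have n0' : 0 < n%:R :> R by rewrite ltr0n.
have n_ge1 : 1 <= n%:R :> R by rewrite ler1n.
have dens : `|(ones (w n))%:R - d * n%:R| <= e / 2 * n%:R.
  have : `|(ones (w n))%:R - d * n%:R| <= e / 2 * `|n%:R|.
    by near: n; apply: wd; rewrite divr_gt0.
  by rewrite normr_nat.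
have expn : forall k, (0 < k <= K)%N ->
    `|n%:R^-1 * \sum_(j < n) (tnth (w n) j)%:R *
        cexp ((2 * pi)%:C * 'i%C / n%:R * k%:R * (j.+1)%:R)| <= delta%:C.
  by near: n.
have small : 8 * (n%:R ^+ 3 / cos 1 ^+ 2 *
    ((2 * K).+1%:R * delta ^+ 2 + K%:R ^- 2)) + 4 * n%:R <= (e / 4 * n%:R) ^+ 3.
  have A_le : n%:R ^+ 3 / cos 1 ^+ 2 * ((2 * K).+1%:R * delta ^+ 2 + K%:R ^- 2)
      <= eta * n%:R ^+ 3.
    have -> : eta * n%:R ^+ 3 = n%:R ^+ 3 / cos 1 ^+ 2 * (h + h).
      by rewrite /h; field; lra.
    by rewrite ler_wpM2l ?divr_ge0 ?exprn_ge0 ?lerD // ltW.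
  have n_ge : 4 / (8 * eta) <= n%:R :> R by near: n; exact: nbhs_infty_ger.
  have : 4 <= 8 * eta * n%:R by move: n_ge; rewrite ler_pdivrMr ?mulr_gt0 // mulrC.
  move=> n4; have : 4 * n%:R <= 8 * eta * n%:R ^+ 3.
    have -> : 8 * eta * n%:R ^+ 3 = 8 * eta * n%:R * n%:R * n%:R by ring.
    rewrite ler_pM2r //; apply: le_trans n4 _.
    by rewrite ler_peMr // !mulr_ge0 // ltW.
  have -> : (e / 4 * n%:R) ^+ 3 = 16 * eta * n%:R ^+ 3.
    by rewrite /eta; field.
  lra.
have r0 : 0 <= e / 4 * n%:R by rewrite mulr_ge0 // divr_ge0 // ltW.
have := prefix_disc_from_expsums n0 K0 (ltW delta_gt0) expn r0 small mn.
have mn1 : `|m%:R / n%:R * ((ones (w n))%:R - d * n%:R)| <= e / 2 * n%:R.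
  rewrite normrM; apply: le_trans dens; rewrite ler_piMl //.
  by rewrite ger0_norm ?divr_ge0 // ler_pdivrMr // mul1r ler_nat.
move: (prefix_disc _ _ _) (_ / _ * _) mn1 => p q q_le pq_le.
by have := ler_normD (p - q) q; rewrite subrK; lra.
Unshelve. all: by end_near. Qed.

End ExponentialSums.

Theorem theorem2 (R : realType) (d : R) (hd : 0 <= d <= 1)
    (w : forall n : nat, n.-tuple bool)
    (hw : (fun n => (ones (w n))%:R : R) =
          (fun n => d * n%:R) +o_\oo (fun n => n%:R : R)) :
  [<->
    (* Uniformity *)
    uniform_seq d w;
    (* Counting *)
    forall (l : nat) (u : l.-tuple bool),
      (fun n => (subword_count (w n) u)%:R : R) =
      (fun n => d ^+ ones u * (1 - d) ^+ (l - ones u) * 'C(n, l)%:R)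
        +o_\oo (fun n => n%:R ^+ l : R);
    (* Minimizer *)
    forall u : 3.-tuple bool,
      (fun n => (subword_count (w n) u)%:R : R) =
      (fun n => d ^+ ones u * (1 - d) ^+ (3 - ones u) * 'C(n, 3)%:R)
        +o_\oo (fun n => n%:R ^+ 3 : R);
    (* Exponential sums *)
    forall k : nat, k <> 0%N ->
      (fun n => n%:R^-1 * \sum_(j < n) (tnth (w n) j)%:R *
                  cexp ((2 * pi)%:C * 'i%C / n%:R * k%:R * (j.+1)%:R) : R[i]^o)
      =o_\oo (fun _ => 1 : R[i]^o);
    (* Equidistribution *)
    forall f : circle R -> R[i], circle_lipschitz f ->
      (fun n => n%:R^-1 * \sum_(j < n) (tnth (w n) j)%:R *
                  f (to_circle ((j.+1)%:R / n%:R)) : R[i]^o)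
      = (fun _ => d%:C * circle_integral f : R[i]^o) +o_\oo (fun _ => 1 : R[i]^o);
    (* Cayley graph *)
    forall u : 3.-tuple bool,
      (fun n => (induced_walk_count (w n) u)%:R : R) =
      (fun n => d ^+ ones u * (1 - d) ^+ (3 - ones u) * (2 * n%:R * 'C(n, 3)%:R))
        +o_\oo (fun n => n%:R ^+ 4 : R)].
Proof.
tfae.
- by move=> /uniform_balanced; exact: balanced_counting.
- by move=> counting u; exact: counting.
- move=> minimizer; apply: (equidistributed_expsum (d := d)).
  by apply: balanced_equidistributed => //; exact: minimizer_balanced.
- by move=> /(expsum_balanced hw); exact: balanced_equidistributed.
- move=> /equidistributed_expsum /(expsum_balanced hw) w_balanced.
  by apply/cayley_minimizer => u; exact: balanced_counting.
- move=> /cayley_minimizer minimizer.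
  by apply/uniform_balanced; exact: minimizer_balanced.
Qed.
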